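(* Let $L, L'$ and $W$ be subsets of a metric space. Suppose that $L$ and $L'$ are totally bounded, or that $W$ is totally bounded. Then $$\mathrm{d_b}\big(\mathsf{dgm}(\mathrm{H}(\check{\mathbb{C}}\mathrm{ech}(L,W))),\ \mathsf{dgm}(\mathrm{H}(\check{\mathbb{C}}\mathrm{ech}(L',W)))\big)\ \leq\ \mathrm{d_H}(L,L').$$
   Context: Fix a field $\mathbf{k}$; $\mathrm{H}$ denotes (total) simplicial homology with coefficients in $\mathbf{k}$. A persistence module $\mathbb{V}$ is a family of $\mathbf{k}$-vector spaces $(V_a)_{a\in\mathbf{R}}$ with linear maps $v_a^b:V_a\to V_b$ for $a\le b$ such that $v_a^a=\mathrm{id}$ and $v_b^c\circ v_a^b=v_a^c$ for $a\le b\le c$. It is q-tame if $r(a,b):=\mathrm{rank}(v_a^b)<\infty$ whenever $a<b$. Persistence diagram of a q-tame module: for $-\infty\le p<q<r<s\le+\infty$ and $R=[p,q]\times[r,s]$ put $\mu(R)=r(q,r)-r(p,r)-r(q,s)+r(p,s)$, where a rank is $0$ if one of its arguments is $\pm\infty$. Then $\mathsf{dgm}(\mathbb{V})$ is the multiset of points $(x,y)$ with $-\infty\le x<y\le+\infty$ in which $(x,y)$ has multiplicity $\min\mu(R)$, the minimum over such rectangles $R$ containing $(x,y)$ in their interior relative to the extended plane $[-\infty,+\infty]^2$. Bottleneck distance: an $\varepsilon$-matching between two such multisets is a partial bijection between them (counting multiplicity) such that matched points are at $\ell^\infty$-distance at most $\varepsilon$ (a point with an infinite coordinate is matched only with a point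 having the same infinite coordinate(s), the finite coordinates differing by at most $\varepsilon$), and every unmatched point $(x,y)$ satisfies $\frac12(y-x)\le\varepsilon$. $\mathrm{d_b}$ is the infimum of the $\varepsilon\geq 0$ for which an $\varepsilon$-matching exists. $\mathrm{d_H}$ is the Hausdorff distance between subsets of the ambient metric space (possibly $+\infty$). A metric space is totally bounded if for every $\varepsilon>0$ it has a finite subset $F$ such that every point is at distance $<\varepsilon$ from some point of $F$. For subsets $L,W$ of a metric space with metric $d$ and $a\in\mathbf{R}$, $\check{\mathrm{C}}\mathrm{ech}(L,W;a)$ is the simplicial complex whose simplices are the nonempty finite subsets $\sigma\subseteq L$ for which there exists $w\in W$ with $d(w,l)\le a$ for all $l\in\sigma$. $\mathrm{H}(\check{\mathbb{C}}\mathrm{ech}(L,W))$ is the persistence module $(\mathrm{H}(\check{\mathrm{C}}\mathrm{ech}(L,W;a)))_{a\in\mathbf{R}}$ with maps induced by inclusions; it is q-tame, so its diagram is defined, when at least one of $L,W$ is totally bounded. *)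

(* Defs.v *)
From HB Require Import structures.
From mathcomp Require Import all_boot all_order all_algebra ring_quotient.
From mathcomp Require Import all_classical all_reals all_analysis.

Set Implicit Arguments.
Unset Strict Implicit.
Unset Printing Implicit Defensive.

Import Order.TTheory GRing.Theory Num.Theory.
Local Open Scope classical_set_scope.
Local Open Scope ring_scope.
Local Open Scope quotient_scope.

Section QuotientModule.
Variables (k : nzRingType) (V : lmodType k) (I : submodClosed V).

Let zmodI : zmod_closed I.
Proof.
split=> [|x y Ix Iy]; first exact: rpred0.
by rewrite -scaleN1r rpredD // rpredZ.
Qed.

Definition submod_zmodClosed : zmodClosed V :=
  HB.pack_for (zmodClosed V) (GRing.SubmodClosed.sort I)
    (GRing.isZmodClosed.Build V _ zmodI).

Local Notation Q := (Quotient.quot submod_zmodClosed).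

Definition quotmod : Type := Q.

HB.instance Definition _ := GRing.Zmodule.on quotmod.

Definition quotmod_scale (a : k) (x : quotmod) : quotmod :=
  \pi_(Q) (a *: repr (x : Q)).

Definition quotmod_pi (x : V) : quotmod := \pi_(Q) x.

Definition quotmod_repr (x : quotmod) : V := repr (x : Q).

Lemma quotmod_reprK x : quotmod_pi (quotmod_repr x) = x.
Proof. exact: reprK. Qed.

Lemma quotmod_piP x y : quotmod_pi x = quotmod_pi y <-> x - y \in I.
Proof.
have E := Quotient.idealrBE submod_zmodClosed x y.
split=> [/eqP xy|xy]; first by move: xy; rewrite -E.
by apply/eqP; rewrite -E.
Qed.

Lemma quotmod_piD x y : quotmod_pi (x + y) = quotmod_pi x + quotmod_pi y.
Proof. exact: (Quotient.pi_add submod_zmodClosed x y). Qed.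

Lemma quotmod_piZ a x : quotmod_pi (a *: x) = quotmod_scale a (quotmod_pi x).
Proof.
apply/quotmod_piP; rewrite -scalerBr; apply: rpredZ.
by apply/quotmod_piP; rewrite quotmod_reprK.
Qed.

Lemma quotmod_scaleA a b x :
  quotmod_scale a (quotmod_scale b x) = quotmod_scale (a * b) x.
Proof. by rewrite -(quotmod_reprK x) -!quotmod_piZ scalerA. Qed.

Lemma quotmod_scale1 : left_id 1 quotmod_scale.
Proof. by move=> x; rewrite -(quotmod_reprK x) -quotmod_piZ scale1r. Qed.

Lemma quotmod_scaleDr : right_distributive quotmod_scale +%R.
Proof.
move=> a x y; rewrite -(quotmod_reprK x) -(quotmod_reprK y).
by rewrite -quotmod_piD -!quotmod_piZ scalerDr quotmod_piD.
Qed.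

Lemma quotmod_scaleDl x :
  {morph (fun a => quotmod_scale a x) : a b / a + b >-> a + b}.
Proof.
move=> a b; rewrite -(quotmod_reprK x) -!quotmod_piZ.
by rewrite scalerDl quotmod_piD.
Qed.

HB.instance Definition _ := GRing.Zmodule_isLmodule.Build k quotmod
  quotmod_scaleA quotmod_scale1 quotmod_scaleDr quotmod_scaleDl.

Lemma quotmod_pi_linear : linear quotmod_pi.
Proof. by move=> a x y; rewrite quotmod_piD quotmod_piZ. Qed.

HB.instance Definition _ :=
  GRing.isLinear.Build k V quotmod *:%R quotmod_pi quotmod_pi_linear.

End QuotientModule.

Record scomplex (T : choiceType) := SComplex {
  simplex : set (set T) ;
  simplex_finite : forall s, simplex s -> finite_set s ;
  simplex_neq0 : forall s, simplex s -> s !=set0 ;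
  simplex_face : forall s t,
    simplex s -> t `<=` s -> t !=set0 -> simplex t }.

Section Homology.
Variables (k : fieldType) (T : choiceType).
Implicit Types (K : scomplex T) (c : seq T -> k^o).

(* Chains of all degrees together: the group of oriented chains of K is the   *)
(* group of finitely supported functions c on finite sequences, alternating,  *)
(* and vanishing on sequences that do not list the vertices of a simplex      *)
(* without repetition; the n-chains are supported on sequences of size n.+1.  *)
(* Transpositions of neighbours generate all sign changes of orientation.     *)
Definition is_chain K c :=
  [/\ finite_set [set s | c s != 0],
      forall s, c s != 0 -> simplex K [set` s],
      forall s, ~~ uniq s -> c s = 0 &
      forall s x y t, c (s ++ x :: y :: t) = - c (s ++ y :: x :: t)].

(* The coefficient of [w_0, ..., w_n] in the boundary of c is the sum of the  *)
(* coefficients of [v, w_0, ..., w_n] in c over all v: this is the boundary   *)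
(* operator with [v_0, ..., v_n] sent to the alternating sum of its faces,    *)
(* see boundary_osimplex. The boundary of a 0-chain is 0.                     *)
Definition boundary c : seq T -> k^o := fun s =>
  if s is [::] then 0 else \sum_(v \in [set: T]) c (v :: s).

Definition is_cycle K c := is_chain K c /\ boundary c = 0.

Definition cycle_pred K : {pred seq T -> k^o} := fun c => `[< is_cycle K c >].

Lemma is_chain0 K : is_chain K 0.
Proof.
split=> [|s|//|s x y t]; last by rewrite oppr0.
- rewrite (_ : [set _ | _] = set0) // -subset0 => s /=.
  by rewrite eqxx.
- by rewrite eqxx.
Qed.

Lemma is_chain_linear K a c d :
  is_chain K c -> is_chain K d -> is_chain K (a *: c + d).
Proof.
move=> [cf cK cu ca] [df dK du da].
have supp s : (a *: c + d) s != 0 -> c s != 0 \/ d s != 0.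
  have [c0|c0] := eqVneq (c s) 0; last by left.
  have [d0|d0] := eqVneq (d s) 0; last by right.
  by rewrite /GRing.add /GRing.scale /= c0 d0 scaler0 addr0 eqxx.
split=> [|s|s su|s x y t].
- have cdf : finite_set ([set s | c s != 0] `|` [set s | d s != 0]).
    by rewrite finite_setU.
  by apply: sub_finite_set cdf => s /supp.
- by move=> /supp[/cK|/dK].
- by rewrite /GRing.add /GRing.scale /= cu // du // scaler0 addr0.
- by rewrite /GRing.add /GRing.scale /= ca da scalerN -opprD.
Qed.

Lemma chain_finite_cons K c s :
  is_chain K c -> finite_set [set v | c (v :: s) != 0].
Proof.
move=> [cf _ _ _]; have inj : injective (fun v : T => v :: s) by move=> ? ? [].
have := @finite_preimage _ _ _ (fun v : T => v :: s) (in2W inj) cf.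
exact.
Qed.

Lemma fsum_undup (r : seq T) (f : T -> k) :
  (forall v, v \notin undup r -> f v = 0) ->
  \sum_(v \in [set: T]) f v = \sum_(v <- undup r) f v.
Proof.
move=> f0; rewrite (fsbigE _ _ (undup_uniq r)) //; last first.
  by move=> v _; exact: f0.
by apply: eq_bigl => v; rewrite in_setT.
Qed.

Lemma boundary_linear K a c d : is_chain K c -> is_chain K d ->
  boundary (a *: c + d) = a *: boundary c + boundary d.
Proof.
move=> Kc Kd; apply/funext => -[|w s].
  by rewrite /GRing.add /GRing.scale /= scaler0 addr0.
have fcd : finite_set ([set v | c (v :: w :: s) != 0] `|`
                      [set v | d (v :: w :: s) != 0]).
  by rewrite finite_setU; split; apply: chain_finite_cons; eassumption.
have [r E] := (finite_seqP _).1 fcd.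
have out v : v \notin undup r -> c (v :: w :: s) = 0 /\ d (v :: w :: s) = 0.
  rewrite mem_undup => vr.
  have nv : ~ ([set v | c (v :: w :: s) != 0] `|`
               [set v | d (v :: w :: s) != 0]) v.
    by rewrite E /=; apply/negP.
  by split; apply/eqP/negPn/negP => ?; apply: nv; [left|right].
change (\sum_(v \in [set: T]) (a * c (v :: w :: s) + d (v :: w :: s))
  = a * \sum_(v \in [set: T]) c (v :: w :: s)
    + \sum_(v \in [set: T]) d (v :: w :: s)).
rewrite !(@fsum_undup r) => [|v /out[]//|v /out[]//|v /out[-> ->]].
  by rewrite big_split /= mulr_sumr.
by rewrite mulr0 addr0.
Qed.

(* The oriented simplex [s_0, ..., s_n] as a chain: its value on a            *)
(* rearrangement of s is the signature of the permutation.                    *)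
Fixpoint inversions (s : seq nat) : nat :=
  if s is i :: s' then (count (fun j => (j < i)%N) s' + inversions s')%N
  else 0%N.

Definition osimplex (s : seq T) : seq T -> k^o := fun t =>
  if uniq s && perm_eq s t then (-1) ^+ inversions [seq index v s | v <- t]
  else 0.

Lemma eq_inversions (f g : T -> nat) (t : seq T) :
  {in t &, forall u v, (f u < f v)%N = (g u < g v)%N} ->
  inversions (map f t) = inversions (map g t).
Proof.
elim: t => //= x t IH fg; congr (_ + _)%N; last first.
  by apply: IH => u v ut vt; apply: fg; rewrite inE (ut, vt) orbT.
rewrite !count_map; apply: eq_in_count => u ut /=.
by apply: fg; rewrite inE ?ut ?eqxx ?orbT.
Qed.

Lemma osimplex_cons (a b : seq T) x t : uniq (a ++ x :: b) ->
  osimplex (a ++ x :: b) (x :: t) = (-1) ^+ size a * osimplex (a ++ b) t :> k.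
Proof.
move=> U; rewrite /osimplex U.
have E : perm_eq (a ++ x :: b) (x :: a ++ b).
  by rewrite perm_catC /= perm_cons perm_catC.
have U' : uniq (x :: a ++ b) by rewrite -(perm_uniq E).
have -> : uniq (a ++ b) by move: U' => /= /andP[].
rewrite (permPl E) perm_cons /=; case: ifPn => [P|_]; last by rewrite mulr0.
rewrite -exprD; congr (_ ^+ _).
have xab : x \notin a ++ b by move: U' => /= /andP[].
have [xa xb] : x \notin a /\ x \notin b.
  by move: xab; rewrite mem_cat negb_or => /andP[].
have ix : index x (a ++ x :: b) = size a.
  by rewrite index_cat (negbTE xa) /= eqxx addn0.
congr (_ + _)%N.
  rewrite ix count_map -(seq.permP P) count_cat.
  rewrite (_ : count _ a = size a); last first.
    apply/eqP; rewrite -all_count; apply/allP => v va /=.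
    by rewrite index_cat va index_mem.
  rewrite (_ : count _ b = 0%N) ?addn0 //; apply/eqP.
  rewrite -leqn0 leqNgt -has_count.
  apply/hasPn => v vb /=; rewrite index_cat.
  have /negbTE -> : v \notin a.
    apply/negP => va; move: U; rewrite cat_uniq => /and3P[_ /hasPn/(_ v)].
    by rewrite inE vb orbT /= va => /(_ isT).
  by rewrite -leqNgt leq_addr.
apply: eq_inversions => u v; rewrite -!(perm_mem P) => uab vab.
have nx w : w \in a ++ b -> x == w = false.
  by move=> wab; apply/negbTE; apply: contraNneq xab => ->.
rewrite !index_cat /= !nx //.
case: ifPn => ua; case: ifPn => va //.
- have := ua; have := va; rewrite -!index_mem => h1 h2.
  by rewrite !ltn_addr.
- have := va; rewrite -index_mem => h.
  by rewrite !ltnNge !(leq_trans (ltnW h)) ?leq_addr.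
- by rewrite !ltn_add2l ltnS.
Qed.

Lemma boundary_osimplex (s : seq T) : uniq s -> (1 < size s)%N ->
  boundary (osimplex s) =
  \sum_(i < size s) (-1) ^+ i *: osimplex (take i s ++ drop i.+1 s).
Proof.
move=> U s1; apply/funext => t; rewrite fct_sumE.
case: t => [|w t].
  rewrite /boundary big1 // => i _; rewrite [LHS]/(_ * _) /osimplex.
  case: ifPn => [/andP[_ /perm_size]|_]; last exact: mulr0.
  rewrite size_cat size_take size_drop ltn_ord /= => /eqP.
  rewrite addn_eq0 subn_eq0 => /andP[/eqP i0].
  by rewrite i0 leqNgt s1.
change (\sum_(v \in [set: T]) osimplex s (v :: w :: t) =
  \sum_(i < size s) (-1) ^+ i * osimplex (take i s ++ drop i.+1 s) (w :: t) :> k).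
rewrite (@fsum_undup s); last first.
  move=> v; rewrite mem_undup => vs; rewrite /osimplex; case: ifPn => //.
  by move=> /andP[_ /perm_mem/(_ v)]; rewrite inE eqxx (negbTE vs).
rewrite undup_id // (big_nth w) big_mkord; apply: eq_bigr => i _.
have E : s = take i s ++ nth w s i :: drop i.+1 s.
  by rewrite -drop_nth // cat_take_drop.
have := @osimplex_cons (take i s) (drop i.+1 s) (nth w s i) (w :: t).
by rewrite -E => /(_ U); rewrite size_take ltn_ord.
Qed.

Lemma cycle_submod_closed K : submod_closed (cycle_pred K).
Proof.
split=> [|a c d].
  apply/asboolP; split; first exact: is_chain0.
  apply/funext => -[|w s] //=; rewrite fsbig1 //.
move=> /asboolP[Kc c0] /asboolP[Kd d0]; apply/asboolP; split.
  exact: is_chain_linear.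
by rewrite (boundary_linear _ Kc Kd) c0 d0 scaler0 addr0.
Qed.

HB.instance Definition _ K := GRing.isSubmodClosed.Build k (seq T -> k^o)
  (cycle_pred K) (cycle_submod_closed K).

Record cycles K := Cycle {
  cycle_val :> seq T -> k^o ;
  cycle_valP : cycle_val \in cycle_pred K }.

HB.instance Definition _ K := [isSub for @cycle_val K].
HB.instance Definition _ K := [Choice of cycles K by <:].
HB.instance Definition _ K := [SubChoice_isSubLmodule of cycles K by <:].

Definition boundary_pred K : {pred cycles K} := fun z =>
  `[< exists2 c, is_chain K c & cycle_val z = boundary c >].

Arguments boundary_pred K : clear implicits.

Lemma boundary_submod_closed K : submod_closed (boundary_pred K).
Proof.
split=> [|a z z'].
  apply/asboolP; exists 0; first exact: is_chain0.
  by apply/funext => -[|w s] //=; rewrite fsbig1.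
move=> /asboolP[c Kc zc] /asboolP[d Kd zd]; apply/asboolP.
exists (a *: c + d); first exact: is_chain_linear.
by rewrite (boundary_linear _ Kc Kd) -zc -zd.
Qed.

HB.instance Definition _ K := GRing.isSubmodClosed.Build k (cycles K)
  (boundary_pred K) (boundary_submod_closed K).

(* Total homology, that is the direct sum of the H_n(K) over all n >= 0.      *)
Definition homology K : Type := quotmod (boundary_pred K).
HB.instance Definition _ K := GRing.Lmodule.on (homology K).

Definition hclass K (z : cycles K) : homology K :=
  quotmod_pi (boundary_pred K) z.

Lemma hclass_surj K (x : homology K) : exists z, x = hclass z.
Proof. by exists (quotmod_repr x); rewrite /hclass quotmod_reprK. Qed.

Section Inclusion.
Variables (K K' : scomplex T) (KK' : simplex K `<=` simplex K').

Lemma is_chain_incl c : is_chain K c -> is_chain K' c.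
Proof. by move=> [? cK ? ?]; split => // s /cK /KK'. Qed.

Lemma cycle_incl_subproof (z : cycles K) : cycle_val z \in cycle_pred K'.
Proof.
case: z => c /= /asboolP[Kc c0]; apply/asboolP; split => //.
exact: is_chain_incl.
Qed.

Definition cycle_incl (z : cycles K) : cycles K' := Cycle (cycle_incl_subproof z).

Definition homology_incl (x : homology K) : homology K' :=
  hclass (cycle_incl (quotmod_repr x)).

Lemma homology_inclE (z : cycles K) :
  homology_incl (hclass z) = hclass (cycle_incl z).
Proof.
apply/quotmod_piP.
have /quotmod_piP /asboolP[c Kc E] := quotmod_reprK (hclass z).
by apply/asboolP; exists c; [exact: is_chain_incl|exact: E].
Qed.

Lemma homology_incl_linear : linear homology_incl.
Proof.
move=> a x y; have [z ->] := hclass_surj x; have [z' ->] := hclass_surj y.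
rewrite -linearP !homology_inclE -[RHS]linearP.
by congr (quotmod_pi _ _); apply: val_inj.
Qed.

HB.instance Definition _ := GRing.isLinear.Build k (homology K) (homology K')
  *:%R homology_incl homology_incl_linear.

End Inclusion.

Lemma homology_incl_id K (KK : simplex K `<=` simplex K) x :
  homology_incl KK x = x.
Proof.
have [z ->] := hclass_surj x; rewrite homology_inclE.
by congr (quotmod_pi _ _); apply: val_inj.
Qed.

Lemma homology_incl_comp K1 K2 K3 (K12 : simplex K1 `<=` simplex K2)
    (K23 : simplex K2 `<=` simplex K3) (K13 : simplex K1 `<=` simplex K3) x :
  homology_incl K23 (homology_incl K12 x) = homology_incl K13 x.
Proof.
have [z ->] := hclass_surj x; rewrite !homology_inclE.
by congr (quotmod_pi _ _); apply: val_inj.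
Qed.

End Homology.

Section Persistence.
Variables (k : fieldType) (R : realType).

Record persmod := PersMod {
  pm_space :> R -> lmodType k ;
  pm_map : forall a b, a <= b -> {linear pm_space a -> pm_space b} ;
  pm_id : forall a (h : a <= a) x, pm_map h x = x ;
  pm_comp : forall a b c (hab : a <= b) (hbc : b <= c) (hac : a <= c) x,
    pm_map hbc (pm_map hab x) = pm_map hac x }.

Definition has_rank (U V : lmodType k) (f : {linear U -> V}) (n : nat) :=
  exists b : 'I_n -> V,
    [/\ forall i, range f (b i),
        forall c : 'I_n -> k, \sum_i c i *: b i = 0 -> forall i, c i = 0 &
        forall y, range f y -> exists c : 'I_n -> k, y = \sum_i c i *: b i].

(* Equal to 0 if the rank is infinite, which does not happen for the maps     *)
(* between distinct indices of a q-tame module.                               *)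
Definition rank (U V : lmodType k) (f : {linear U -> V}) : nat :=
  xget 0%N [set n | has_rank f n].

Definition q_tame (V : persmod) := forall a b (hab : a <= b), a < b ->
  exists n, has_rank (pm_map V hab) n.

Definition pm_rank (V : persmod) (a b : \bar R) : int :=
  match a, b with
  | a'%:E, b'%:E =>
      if pselect (a' <= b') is left h then (rank (pm_map V h))%:Z else 0
  | _, _ => 0
  end.

Definition pm_mu (V : persmod) (p q r s : \bar R) : int :=
  pm_rank V q r - pm_rank V p r - pm_rank V q s + pm_rank V p s.

(* The values of mu on the rectangles having z in their interior, which is    *)
(* taken in the extended plane.                                               *)
Definition pm_mu_at (V : persmod) (z : \bar R * \bar R) : set int :=
  [set m | exists p q r s, [/\ (p < q)%E, (q < r)%E, (r < s)%E,
    (([set` `[p, q]] `*` [set` `[r, s]])°) z & m = pm_mu V p q r s]].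

(* A persistence diagram is given by its multiplicity function. For q-tame    *)
(* modules, mu is nonnegative and its minimum in the definition exists.       *)
Definition diagram := \bar R * \bar R -> nat.

Definition dgm (V : persmod) : diagram := fun z =>
  if (z.1 < z.2)%E then
    xget 0%N [set n : nat | pm_mu_at V z n%:Z /\
                            forall m, pm_mu_at V z m -> n%:Z <= m]
  else 0%N.

(* The points of a multiset, the copies of a point being numbered.            *)
Definition points (D : diagram) : set ((\bar R * \bar R) * nat) :=
  [set u | (u.2 < D u.1)%N].

Definition coord_close (e : R) (x y : \bar R) : Prop :=
  match x, y with
  | EFin x', EFin y' => `|x' - y'| <= e
  | +oo%E, +oo%E | -oo%E, -oo%E => True
  | _, _ => False
  end.

Definition is_matching (e : R) (D D' : diagram)
    (M : ((\bar R * \bar R) * nat) -> ((\bar R * \bar R) * nat) -> Prop) :=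
  [/\ forall u v, M u v -> points D u /\ points D' v,
      forall u v v', M u v -> M u v' -> v = v',
      forall u u' v, M u v -> M u' v -> u = u',
      forall u v, M u v -> coord_close e u.1.1 v.1.1 /\ coord_close e u.1.2 v.1.2 &
      (forall u, points D u -> (forall v, ~ M u v) ->
         ((2^-1)%:E * (u.1.2 - u.1.1) <= e%:E)%E) /\
      (forall v, points D' v -> (forall u, ~ M u v) ->
         ((2^-1)%:E * (v.1.2 - v.1.1) <= e%:E)%E)].

Definition bottleneck (D D' : diagram) : \bar R :=
  ereal_inf [set e%:E | e in [set e : R | 0 <= e /\
                                exists M, is_matching e D D' M]].

End Persistence.

Section FilteredHomology.
Variables (k : fieldType) (R : realType) (T : choiceType).
Variables (F : R -> scomplex T).
Hypothesis F_mono : forall a b, a <= b -> simplex (F a) `<=` simplex (F b).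

Definition homology_persmod : persmod k R := PersMod
  (pm_space := fun a => homology k (F a))
  (pm_map := fun a b h => homology_incl (F_mono h))
  (fun a h => homology_incl_id (F_mono h))
  (fun a b c hab hbc hac =>
     homology_incl_comp (F_mono hab) (F_mono hbc) (F_mono hac)).

End FilteredHomology.

Section Metric.
Variables (R : realType) (X : metricType R).
Implicit Types L W : set X.

Definition totally_bounded L := forall e : R, 0 < e ->
  exists F : set X, [/\ finite_set F, F `<=` L &
    forall x, L x -> exists2 y, F y & mdist x y < e].

(* Equal to 0 if both sets are empty and to +oo if exactly one is.            *)
Definition hausdorff_dist L L' : \bar R :=
  ereal_inf [set e%:E | e in [set e : R | [/\ 0 <= e,
    forall x, L x -> exists2 y, L' y & mdist x y <= e &
    forall y, L' y -> exists2 x, L x & mdist x y <= e]]].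

Definition cech_simplex L W (a : R) : set (set X) :=
  [set s | [/\ finite_set s, s !=set0, s `<=` L &
    exists2 w, W w & forall l, s l -> mdist w l <= a]].

Lemma cech_face L W a s t : cech_simplex L W a s -> t `<=` s -> t !=set0 ->
  cech_simplex L W a t.
Proof.
move=> [sf _ sL [w Ww wd]] ts t0; split => //.
- exact: sub_finite_set ts sf.
- exact: subset_trans ts sL.
- by exists w => // l /ts /wd.
Qed.

Definition cech L W a : scomplex X := @SComplex X (cech_simplex L W a)
  (fun s => fun '(And4 sf _ _ _) => sf) (fun s => fun '(And4 _ s0 _ _) => s0)
  (@cech_face L W a).

Lemma cech_mono L W a b : a <= b ->
  simplex (cech L W a) `<=` simplex (cech L W b).
Proof.
move=> ab s [sf s0 sL [w Ww wd]]; split => //.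
by exists w => // l /wd /le_trans; exact.
Qed.

Definition cech_homology (k : fieldType) L W : persmod k R :=
  homology_persmod k (@cech_mono L W).

End Metric.

(* Main.v *)
Require Import Defs.
From mathcomp Require Import all_boot all_order all_algebra.
From mathcomp Require Import all_classical all_reals all_analysis.
From mathcomp Require Import zify lra.

(** Let every point of [L] be within [e] of [L'] and conversely. It suffices to
    find an [e]-matching of the two diagrams, and this is done by comparing the
    Cech modules [V] of [L] and [V'] of [L'] with the module [U] of the union
    [L `|` L'].

    The inclusion [L `<=` L `|` L'] induces a morphism [h : V -> U] whose kernel
    and cokernel vanish after shifting by [e]. Indeed, moving the points of
    [L'] outside [L] to points of [L] at distance at most [e] pushes a chain of
    [U] at [a] into [V] at [a + e]. Moving the vertices one at a time, each
    move is chain homotopic to the identity by an explicit homotopy made of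
    cones, as the old and the new position span a simplex together with the
    rest (retract_chain, cech_shift_matched). The same argument with a finite
    set of vertices shows that the modules are q-tame (cech_q_tame).

    The image [I] of [h] is a quotient of [V] and a submodule of [U]. As the
    shift of [V] by [e] factors through [I], for births in a window [p, q] and
    deaths after [t] the quotients im(V_q) / im(V_p) at [t], the same for [I],
    and the same for [V] at [t + e] map onto each other successively. So on
    each vertical line of the plane, the i-th highest point of the diagram of
    [I] lies below that of [V] by at most [e]: matching points of equal rank on
    each line moves deaths only (line_matching). The inclusion of [I] in [U]
    has the same property with births and deaths exchanged, and is treated by
    reversing the real line. Composing, the diagrams of [V] and [U] are matched
    with both coordinates decreasing by at most [e] (image_matching,
    morphism_matching). The image [I] enters through its rank function only.

    Since the coordinates of a point of [V] and those of a point of [V'] matched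
    to the same point [(b, d)] of [U] lie in the intervals from [b] to [b + e]
    and from [d] to [d + e], the two
    matchings compose to an [e]-matching rather than a [2 * e]-matching
    (bottleneck_le). *)

Set Implicit Arguments.
Unset Strict Implicit.
Unset Printing Implicit Defensive.

Import Order.TTheory GRing.Theory Num.Theory numFieldNormedType.Exports.
Local Open Scope classical_set_scope.
Local Open Scope ring_scope.

(** * Dimension of subspaces of arbitrary vector spaces *)

Section Dimension.
Variable k : fieldType.
Implicit Types V W : lmodType k.

Definition independent V (I : finType) (b : I -> V) :=
  forall c : I -> k, \sum_i c i *: b i = 0 -> forall i, c i = 0.

Definition in_span V (I : finType) (b : I -> V) (x : V) :=
  exists c : I -> k, x = \sum_i c i *: b i.

Definition is_subspace V (A : set V) :=
  A 0 /\ forall a x y, A x -> A y -> A (a *: x + y).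

Definition has_dim V (A : set V) (n : nat) :=
  exists b : 'I_n -> V, [/\ forall i, A (b i), independent b &
    forall y, A y -> in_span b y].

Definition set_dim V (A : set V) : nat := xget 0%N [set n | has_dim A n].

Lemma subspace_sum V (A : set V) (I : finType) (c : I -> k) (b : I -> V) :
  is_subspace A -> (forall i, A (b i)) -> A (\sum_i c i *: b i).
Proof.
move=> [A0 AD] Ab; elim/big_ind: _ => // [x y Ax Ay|i _].
  by rewrite -(scale1r x); exact: AD.
by rewrite -(addr0 (_ *: _)); exact: AD.
Qed.

Lemma subspace_sub V (A : set V) x y : is_subspace A -> A x -> A y -> A (x - y).
Proof. by move=> [_ AD] Ax Ay; rewrite addrC -scaleN1r; exact: AD. Qed.

Lemma subspace_range V W (f : {linear V -> W}) : is_subspace (range f).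
Proof.
split=> [|a _ _ [x _ <-] [y _ <-]]; first by exists 0 => //; exact: linear0.
by exists (a *: x + y) => //; exact: linearP.
Qed.

Lemma subspace_image V W (f : {linear V -> W}) (A : set V) :
  is_subspace A -> is_subspace (f @` A).
Proof.
move=> [A0 AD]; split=> [|a _ _ [x Ax <-] [y Ay <-]].
  by exists 0 => //; exact: linear0.
by exists (a *: x + y); [exact: AD|exact: linearP].
Qed.

Lemma subspace0 V : is_subspace [set (0 : V)].
Proof. by split=> // a x y /= -> ->; rewrite scaler0 addr0. Qed.

(** With more vectors than generators, the matrix of coefficients has a
    nonzero vector in its left kernel. *)
Lemma independent_card_le V (I J : finType) (b : I -> V) (c : J -> V) :
  independent b -> (forall i, in_span c (b i)) -> (#|I| <= #|J|)%N.
Proof.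
move=> bI /choice[M bM]; rewrite leqNgt; apply/negP => JI.
pose A : 'M[k]_(#|I|, #|J|) := \matrix_(i, j) M (enum_val i) (enum_val j).
have : kermx A != 0.
  by rewrite kermx_eq0 -row_leq_rank -ltnNge (leq_ltn_trans (rank_leq_col A)).
case/rowV0Pn => u /sub_kermxP uA /eqP; apply; apply/rowP => i.
rewrite mxE -(enum_valK i).
pose d (x : I) := u 0 (enum_rank x); change (d (enum_val i) = 0).
apply: bI; under eq_bigr => x _ do rewrite bM scaler_sumr.
rewrite exchange_big big1 // => j _.
under eq_bigr => x _ do rewrite scalerA.
rewrite -scaler_suml; suff -> : \sum_x d x * M x j = 0 by rewrite scale0r.
have /matrixP/(_ 0 (enum_rank j)) := uA.
rewrite !mxE; apply: etrans; rewrite [LHS](reindex (enum_val (A := I))) /=; last first.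
  exact: onW_bij (enum_val_bij I).
by apply: eq_bigr => x _; rewrite !mxE /d enum_valK enum_rankK.
Qed.

Lemma has_dim_unique V (A : set V) n m : has_dim A n -> has_dim A m -> n = m.
Proof.
move=> [b [Ab bI bs]] [c [Ac cI cs]].
by apply/eqP; rewrite eqn_leq -(card_ord n) -(card_ord m);
  rewrite (independent_card_le bI (fun i => cs _ (Ab i)));
  rewrite (independent_card_le cI (fun i => bs _ (Ac i))).
Qed.

Lemma set_dimE V (A : set V) n : has_dim A n -> set_dim A = n.
Proof.
move=> An; have : has_dim A (set_dim A) by apply: (xgetPex 0%N (P := has_dim A)); exists n.
by move=> /has_dim_unique; exact.
Qed.

Definition pair_fam V (I J : finType) (b : I -> V) (c : J -> V) :
  I + J -> V := fun x => match x with inl i => b i | inr j => c j end.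

(** A family with a maximal number of vectors added spans: any vector outside
    its span could be added too. *)
Lemma independent_extend V (A : set V) N (I : finType) (b : I -> V) :
  (forall m (c : 'I_m -> V), (forall i, A (c i)) ->
     independent (pair_fam b c) -> (m <= N)%N) ->
  independent b ->
  exists l (c : 'I_l -> V), [/\ forall i, A (c i), independent (pair_fam b c) &
    forall y, A y -> in_span (pair_fam b c) y].
Proof.
move=> bound bI.
pose P l := exists c : 'I_l -> V, (forall i, A (c i)) /\ independent (pair_fam b c).
have P0 : P 0%N.
  have c : 'I_0 -> V by case.
  exists c; split=> [[]//|d]; rewrite big_sumType /= big_ord0 addr0.
  by move=> /bI d0 [i|[]//]; exact: d0.
have bP l : `[< P l >] -> (l <= N)%N.
  by move=> /asboolP[c [Ac cI]]; exact: bound Ac cI.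
case: (ex_maxnP (ex_intro (fun l => `[< P l >]) _ (asboolT P0)) bP).
move=> l /asboolP[c [Ac cI]] lmax; exists l, c; split=> // y Ay.
apply: contrapT => ny.
pose c' (i : 'I_l.+1) := if unlift ord0 i is Some j then c j else y.
suff /asboolP/lmax : P l.+1 by rewrite ltnn.
exists c'; split=> [i|d]; first by rewrite /c'; case: unlift.
rewrite big_sumType big_ord_recl /= {1}/c' unlift_none.
under [X in _ + (_ + X)]eq_bigr => i _ do rewrite /c' liftK.
move=> E.
pose d' (x : I + 'I_l) := match x with inl i => d (inl i)
  | inr j => d (inr (lift ord0 j)) end.
have E' : d (inr ord0) *: y + \sum_x d' x *: pair_fam b c x = 0.
  by rewrite big_sumType /= -[RHS]E addrCA.
have dy : d (inr ord0) = 0.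
  apply/eqP/negPn/negP => d0; apply: ny.
  exists (fun x => - (d (inr ord0))^-1 * d' x).
  under eq_bigr => x _ do rewrite -scalerA.
  rewrite -scaler_sumr; move/eqP: E'; rewrite addrC addr_eq0 => /eqP ->.
  by rewrite scalerN scaleNr opprK scalerA mulVf // scale1r.
move: E'; rewrite dy scale0r add0r => /cI d0 [i|j].
  exact: (d0 (inl i)).
case: (unliftP ord0 j) => [j'|] ->; last exact: dy.
exact: (d0 (inr j')).
Qed.

Lemma independent0 V (b : 'I_0 -> V) : independent b.
Proof. by move=> c _ []. Qed.

(** A maximal independent family is a basis. *)
Lemma has_dim_bounded V (A : set V) N :
  (forall m (b : 'I_m -> V), (forall i, A (b i)) -> independent b ->
     (m <= N)%N) -> exists n, has_dim A n.
Proof.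
move=> bound; have b : 'I_0 -> V by case.
have [|l [c [Ac cI cs]]] := @independent_extend V A N _ b _ (@independent0 V b).
  move=> m c Ac bc; apply: (bound m c Ac) => d dc i.
  pose d' (x : 'I_0 + 'I_m) := match x with inl _ => 0 | inr i => d i end.
  apply: (bc d' _ (inr i)).
  by rewrite big_sumType /= big_ord0 add0r.
exists l, c; split=> // [d dc i|y Ay].
  pose d' (x : 'I_0 + 'I_l) := match x with inl _ => 0 | inr i => d i end.
  apply: (cI d' _ (inr i)).
  by rewrite big_sumType /= big_ord0 add0r.
have [d ->] := cs _ Ay; exists (fun i => d (inr i)).
by rewrite big_sumType /= big_ord0 add0r.
Qed.

Lemma has_dim_sub V (A B : set V) n :
  has_dim A n -> B `<=` A -> exists m, has_dim B m.
Proof.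
move=> [b [_ _ bs]] BA; apply: (@has_dim_bounded _ _ n) => m c Bc cI.
by have := independent_card_le cI (fun i => bs _ (BA _ (Bc i))); rewrite !card_ord.
Qed.

Lemma has_dim_image V W (f : {linear V -> W}) (A : set V) n :
  has_dim A n -> exists m, has_dim (f @` A) m.
Proof.
move=> [b [_ _ bs]]; apply: (@has_dim_bounded _ _ n) => m c Bc cI.
have : forall i, in_span (f \o b) (c i).
  move=> i; have [x Ax <-] := Bc i; have [d ->] := bs _ Ax; exists d.
  by rewrite linear_sum; apply: eq_bigr => j _; rewrite linearZ.
by move/(independent_card_le cI); rewrite !card_ord.
Qed.

Lemma has_dim0 V : has_dim [set (0 : V)] 0.
Proof.
have b : 'I_0 -> V by case.
by exists b; split=> [[]//|//|y ->]; [exact: independent0|exists (fun=> 0); rewrite big_ord0].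
Qed.

(** If [ker h] is contained in [ker g], then [h A / h B] maps onto
    [g A / g B]. All the rank inequalities needed for persistence modules are
    instances of this one. *)
Lemma dim_quotient_le V W1 W2 (g : {linear V -> W1}) (h : {linear V -> W2})
    (A B : set V) n m n' m' : is_subspace A -> is_subspace B -> B `<=` A ->
  (forall x, A x -> h x = 0 -> g x = 0) ->
  has_dim (h @` A) n -> has_dim (h @` B) m ->
  has_dim (g @` A) n' -> has_dim (g @` B) m' -> (n' + m <= n + m')%N.
Proof.
move=> sA sB BA hg [hA [hAA hAI hAs]] [hB [hBB hBI hBs]] [gA [gAA gAI gAs]]
  [gB [gBB gBI gBs]].
have /choice[b bE] i : exists x, B x /\ h x = hB i.
  by have [x] := hBB i; exists x.
have bB i : B (b i) by case: (bE i).
have hb i : h (b i) = hB i by case: (bE i).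
have [|l [c [Ac cI cs]]] := @independent_extend _ (h @` A) n _ hB _ hBI.
  move=> l c Ac cI; have := independent_card_le cI (c := hA).
  rewrite card_sum !card_ord => /(_ _)/(leq_trans (leq_addl _ _)); apply.
  move=> [i|i] /=; apply: hAs => //.
  by have [x Bx <-] := hBB i; exists x => //; exact: BA.
have lm : (m + l <= n)%N.
  have := independent_card_le cI (c := hA).
  rewrite card_sum !card_ord; apply => -[i|i] /=; apply: hAs => //.
  by have [x Bx <-] := hBB i; exists x => //; exact: BA.
have /choice[a aE] i : exists x, A x /\ h x = c i.
  by have [x] := Ac i; exists x.
have aA i : A (a i) by case: (aE i).
have ha i : h (a i) = c i by case: (aE i).
have : forall i, in_span (pair_fam gB (g \o a)) (gA i).
  move=> i; have [x Ax <-] := gAA i.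
  have [d hx] := cs _ (imageP h Ax).
  pose y := \sum_i d (inl i) *: b i.
  pose z := \sum_i d (inr i) *: a i.
  have By : B y by exact: subspace_sum.
  have Az : A z by exact: subspace_sum.
  have g0 : g (x - y - z) = 0.
    apply: hg; first by apply: subspace_sub => //; apply: subspace_sub => //; exact: BA.
    have hy : h y = \sum_i d (inl i) *: hB i.
      by rewrite linear_sum; apply: eq_bigr => j _; rewrite linearZ hb.
    have hz : h z = \sum_i d (inr i) *: c i.
      by rewrite linear_sum; apply: eq_bigr => j _; rewrite linearZ ha.
    by rewrite !linearB hx big_sumType /= hy hz -addrA -opprD subrr.
  have [f gy] := gBs _ (imageP g By).
  exists (fun u => match u with inl i => f i | inr j => d (inr j) end).
  have gz : g z = \sum_i d (inr i) *: g (a i).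
    by rewrite linear_sum; apply: eq_bigr => j _; rewrite linearZ.
  rewrite big_sumType /= -gy -gz -linearD; apply/eqP.
  by rewrite -subr_eq0 -linearB opprD addrA g0.
move=> /(independent_card_le gAI); rewrite card_sum !card_ord => ?.
by lia.
Qed.

End Dimension.

(** * Diagrams of rank functions *)

Lemma int_set_min (P : set int) : P !=set0 -> (forall m, P m -> 0 <= m) ->
  exists n : nat, P n%:Z /\ forall m, P m -> n%:Z <= m.
Proof.
move=> [m0 Pm0] P0.
have ex : exists n, `[< P n%:Z >].
  by exists `|m0|%N; rewrite gez0_abs ?P0 //; exact: asboolT.
case: (ex_minnP ex) => n /asboolP Pn nmin; exists n; split=> // m Pm.
have := P0 _ Pm; case: m Pm => // m Pm _.
by rewrite lez_nat; apply: nmin; exact: asboolT.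
Qed.

Lemma ereal_between (R : realType) (x y : \bar R) : (x < y)%E ->
  exists z : R, (x < z%:E)%E /\ (z%:E < y)%E.
Proof.
case: x y => [x||] [y||] //; rewrite ?lte_fin => xy.
- by exists ((x + y) / 2); rewrite !lte_fin !(midf_lt xy).
- by exists (x + 1); rewrite lte_fin ltrDl ltr01 ltry.
- by exists (y - 1); rewrite lte_fin gtrBl ltr01 ltNyr.
- by exists 0; rewrite ltry ltNyr.
Qed.

Section RankFunctions.
Variable R : realType.
Implicit Types (rho : \bar R -> \bar R -> int) (x y p q r s t : \bar R).

(** Membership in the interior relative to the extended line, at the left and
    right end of an interval. *)
Definition right_of p x : Prop := (p < x)%E \/ p = -oo%E /\ x = -oo%E.
Definition left_of y s : Prop := (y < s)%E \/ s = +oo%E /\ y = +oo%E.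

Definition rank_mu rho p q r s : int := rho q r - rho p r - rho q s + rho p s.

Record rank_function rho : Prop := RankFunction {
  rank_mu_ge0 : forall p q r s, (p < q)%E -> (q < r)%E -> (r < s)%E ->
    0 <= rank_mu rho p q r s ;
  rank_right_infty : forall p, rho p +oo%E = 0 ;
  rank_left_infty : forall t, rho -oo%E t = 0 }.

Definition mu_at rho (z : \bar R * \bar R) : set int :=
  [set m | exists p q r s, [/\ right_of p z.1, (z.1 < q)%E, (q < r)%E,
     (r < z.2)%E & left_of z.2 s] /\ m = rank_mu rho p q r s].

Definition rank_dgm rho : diagram R := fun z =>
  if (z.1 < z.2)%E then
    xget 0%N [set n : nat | mu_at rho z n%:Z /\
                            forall m, mu_at rho z m -> n%:Z <= m]
  else 0%N.

Definition increment rho p q t : int := rho q t - rho p t.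

(** As the window shrinks to [x], its increment decreases to the number of points
    of the diagram that lie over [x] and higher than [t], up to points at height
    [t] itself. *)
Definition is_line_count rho x t (n : nat) :=
  (exists p q, [/\ right_of p x, (x < q)%E, (q < t)%E &
     increment rho p q t = n%:Z]) /\
  forall p q, right_of p x -> (x < q)%E -> (q < t)%E ->
    n%:Z <= increment rho p q t.

Definition line_count rho x t : nat := xget 0%N (is_line_count rho x t).

Lemma right_of_infty x : right_of -oo%E x.
Proof.
by case: (ltgtP x -oo%E) => [|h|->]; [rewrite ltNge leNye|left|right].
Qed.

Lemma left_of_infty y : left_of y +oo%E.
Proof.
by case: (ltgtP y +oo%E) => [h||->]; [left|rewrite ltNge leey|right].
Qed.

Lemma right_of_le p x : right_of p x -> (p <= x)%E.
Proof. by case=> [/ltW|[-> ->]]. Qed.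

Lemma left_of_le y s : left_of y s -> (y <= s)%E.
Proof. by case=> [/ltW|[-> ->]]. Qed.

Lemma right_of_max p p' x : right_of p x -> right_of p' x ->
  right_of (Order.max p p') x.
Proof. by move=> h h'; rewrite maxEle; case: ifP. Qed.

Section OneFunction.
Variables (rho : \bar R -> \bar R -> int) (rf : rank_function rho).

Lemma rank_homo p q t : (p <= q)%E -> (q < t)%E -> rho p t <= rho q t.
Proof.
rewrite le_eqVlt => /predU1P[->//|pq] qt.
(* The rectangle with the sides [p, q] and [t, +oo], where ranks at [+oo] vanish. *)
have [->|t_oo] := eqVneq t +oo%E; first by rewrite !rank_right_infty.
have := rank_mu_ge0 rf pq qt (_ : (t < +oo)%E).
rewrite ltey => /(_ t_oo); rewrite /rank_mu !rank_right_infty //; lia.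
Qed.

Lemma increment_ge0 p q t : (p <= q)%E -> (q < t)%E -> 0 <= increment rho p q t.
Proof. by move=> pq qt; rewrite subr_ge0 rank_homo. Qed.

Lemma increment_anti p q r s : (p <= q)%E -> (q < r)%E -> (r <= s)%E ->
  increment rho p q s <= increment rho p q r.
Proof.
rewrite le_eqVlt => /predU1P[->|pq] qr.
  by rewrite /increment !subrr.
rewrite le_eqVlt => /predU1P[->//|rs].
have := rank_mu_ge0 rf pq qr rs; rewrite /rank_mu /increment; lia.
Qed.

Lemma increment_window p p' q' q t : (p <= p')%E -> (p' <= q')%E ->
  (q' <= q)%E -> (q < t)%E -> increment rho p' q' t <= increment rho p q t.
Proof.
move=> pp' pq qq' qt; rewrite /increment.
have := rank_homo pp' (le_lt_trans pq (le_lt_trans qq' qt)).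
have := rank_homo qq' qt; lia.
Qed.

Lemma mu_window p p' q' q r s : (p <= p')%E -> (p' <= q')%E ->
  (q' <= q)%E -> (q < r)%E -> (r <= s)%E ->
  rank_mu rho p' q' r s <= rank_mu rho p q r s.
Proof.
move=> pp' pq qq' qr rs.
have := increment_anti pp' (le_lt_trans pq (le_lt_trans qq' qr)) rs.
have := increment_anti qq' qr rs.
rewrite /increment /rank_mu; lia.
Qed.

Lemma line_countP x t : (x < t)%E -> is_line_count rho x t (line_count rho x t).
Proof.
move=> xt; apply: (xgetPex 0%N (P := is_line_count rho x t)).
have [||n [Pn nmin]] := @int_set_min [set m | exists p q, [/\ right_of p x,
    (x < q)%E, (q < t)%E & increment rho p q t = m]].
- have [q [xq qt]] := ereal_between xt.
  exists (increment rho -oo%E q%:E t), -oo%E, q%:E; split=> //.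
  exact: right_of_infty.
- move=> _ [p [q [px xq qt <-]]]; apply: increment_ge0 => //.
  exact: le_trans (right_of_le px) (ltW xq).
exists n; split=> // p q px xq qt; apply: nmin.
by exists p, q.
Qed.

Lemma line_count_infty x : (x < +oo)%E -> line_count rho x +oo%E = 0%N.
Proof.
move=> /line_countP[[p [q [_ _ _]]]]; rewrite /increment !rank_right_infty //.
by case: line_count.
Qed.

Lemma line_count_anti x t t' : (x < t)%E -> (t <= t')%E ->
  (line_count rho x t' <= line_count rho x t)%N.
Proof.
move=> xt tt'.
have [[p [q [px xq qt E]]] _] := line_countP xt.
have [_ /(_ p q px xq (lt_le_trans qt tt')) h] := line_countP (lt_le_trans xt tt').
rewrite -lez_nat -E (le_trans h) // increment_anti //.
exact: le_trans (right_of_le px) (ltW xq).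
Qed.

(** Increments decrease when the window shrinks, so the intersection of two
    windows computing one line count each computes both. *)
Lemma line_count_window x r s p q : (x < r)%E -> (r <= s)%E ->
    right_of p x -> (x < q)%E ->
  exists p' q', [/\ right_of p' x, (p <= p')%E, (x < q')%E, (q' <= q)%E &
    [/\ (q' < r)%E, increment rho p' q' r = (line_count rho x r)%:Z &
    increment rho p' q' s = (line_count rho x s)%:Z]].
Proof.
move=> xr rs px xq.
have [[p1 [q1 [px1 xq1 qr1 E1]]] min1] := line_countP xr.
have [[p2 [q2 [px2 xq2 qr2 E2]]] min2] := line_countP (lt_le_trans xr rs).
pose p' := Order.max p (Order.max p1 p2); pose q' := Order.min q (Order.min q1 q2).
have px' : right_of p' x by do 2 apply: right_of_max => //.
have xq' : (x < q')%E by rewrite !lt_min xq xq1 xq2.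
have pq' : (p' <= q')%E := le_trans (right_of_le px') (ltW xq').
have [pp' pp1 pp2] : [/\ p <= p', p1 <= p' & p2 <= p']%E.
  by rewrite /p' !le_max !lexx !orbT.
have [qq' qq1 qq2] : [/\ q' <= q, q' <= q1 & q' <= q2]%E.
  by rewrite /q' !ge_min !lexx !orbT.
exists p', q'; split=> //; split; first exact: le_lt_trans qq1 qr1.
  apply/eqP; rewrite eq_le min1 ?(le_lt_trans qq1 qr1) // andbT -E1.
  exact: increment_window.
apply/eqP; rewrite eq_le min2 ?(le_lt_trans qq2 qr2) // andbT -E2.
exact: increment_window.
Qed.

(** The measure of a rectangle is a difference of two increments over one
    window; once the window computes the line counts, only the heights of
    the rectangle are left to shrink. *)
Lemma rank_dgmP x y : (x < y)%E ->
  (exists r s, [/\ (x < r)%E, (r < y)%E, left_of y s &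
    (rank_dgm rho (x, y))%:Z = (line_count rho x r)%:Z - (line_count rho x s)%:Z])
  /\ forall r s, (x < r)%E -> (r < y)%E -> left_of y s ->
    (rank_dgm rho (x, y))%:Z <= (line_count rho x r)%:Z - (line_count rho x s)%:Z.
Proof.
move=> xy; rewrite /rank_dgm /= xy.
set P := [set n : nat | _].
have PN : P (xget 0%N P).
  apply: xgetPex; apply: int_set_min.
    have [r [xr ry]] := ereal_between xy; have [q [xq qr]] := ereal_between xr.
    exists (rank_mu rho -oo%E q%:E r%:E +oo%E), -oo%E, q%:E, r%:E, +oo%E.
    by split=> //; split=> //; [exact: right_of_infty|exact: left_of_infty].
  move=> _ [p [q [r [s [[/= px xq qr ry ys] ->]]]]].
  have := increment_anti (le_trans (right_of_le px) (ltW xq)) qr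
    (le_trans (ltW ry) (left_of_le ys)).
  rewrite /rank_mu /increment; lia.
move: (xget _ _) PN => n [[p [q [r [s [[/= px xq qr ry ys] nE]]]]] nmin].
have lower r' s' : (x < r')%E -> (r' < y)%E -> left_of y s' ->
    n%:Z <= (line_count rho x r')%:Z - (line_count rho x s')%:Z.
  move=> xr' ry' ys'.
  have rs' := le_trans (ltW ry') (left_of_le ys').
  have [p' [q' [px' pp' xq' qq' [qr' <- <-]]]] := line_count_window xr' rs' px xq.
  apply: nmin; exists p', q', r', s'; split=> //.
  by rewrite /rank_mu /increment; lia.
split=> //; have xr := lt_trans xq qr; have rs := le_trans (ltW ry) (left_of_le ys).
exists r, s; split=> //; apply/eqP; rewrite eq_le lower //= nE.
have [p' [q' [px' pp' xq' qq' [qr' <- <-]]]] := line_count_window xr rs px xq.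
have := mu_window pp' (le_trans (right_of_le px') (ltW xq')) qq' qr rs.
by rewrite /rank_mu /increment; lia.
Qed.

End OneFunction.

(** The number of points over [x] strictly higher than [y], as the largest line
    count at heights above [y]. *)
Definition count_above rho x y : nat :=
  xget 0%N [set n | (exists2 s, left_of y s & line_count rho x s = n) /\
                    forall s, left_of y s -> (line_count rho x s <= n)%N].

(** Numbering the points over [x] from the top down, starting from [0], the
    point with number [j] has height [y]. *)
Definition is_level rho x (j : nat) y :=
  [/\ (x < y)%E, forall s, left_of y s -> (line_count rho x s <= j)%N &
      forall r, (x < r)%E -> (r < y)%E -> (j < line_count rho x r)%N].

(** The number of a point on its vertical line, copies of a point being counted
    one after the other. *)
Definition label rho (u : (\bar R * \bar R) * nat) : nat :=
  (count_above rho u.1.1 u.1.2 + u.2)%N.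

Section Levels.
Variables (rho : \bar R -> \bar R -> int) (rf : rank_function rho).

Lemma count_aboveP x y : (x < y)%E ->
  (exists2 s, left_of y s & line_count rho x s = count_above rho x y) /\
  forall s, left_of y s -> (line_count rho x s <= count_above rho x y)%N.
Proof.
move=> xy; set P := [set n | (exists2 s, left_of y s & line_count rho x s = n) /\
  forall s, left_of y s -> (line_count rho x s <= n)%N].
suff : P (count_above rho x y) by [].
apply: (xgetPex 0%N (P := P)).
pose Q n := `[< exists2 s, left_of y s & line_count rho x s = n >].
have exQ : exists n, Q n.
  exists (line_count rho x +oo%E); apply: asboolT.
  by exists +oo%E => //; exact: left_of_infty.
have [r [xr ry]] := ereal_between xy.
have bQ n : Q n -> (n <= line_count rho x r%:E)%N.
  move=> /asboolP[s ys <-]; apply: line_count_anti => //.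
  exact: le_trans (ltW ry) (left_of_le ys).
case: (ex_maxnP exQ bQ) => n /asboolP Qn nmax; exists n; split=> // s ys.
by apply: nmax; apply: asboolT; exists s.
Qed.

Lemma rank_dgm_lt x y i : (i < rank_dgm rho (x, y))%N -> (x < y)%E.
Proof. by rewrite /rank_dgm /=; case: ifP. Qed.

Lemma points_level u : points (rank_dgm rho) u ->
  is_level rho u.1.1 (label rho u) u.1.2.
Proof.
case: u => [[x y] i] /= iD; have xy := rank_dgm_lt iD.
have [[s ys sE] amax] := count_aboveP xy.
split=> //= [s' /amax h|r xr ry]; first exact: leq_trans h (leq_addr _ _).
have [_ /(_ r s xr ry ys)] := rank_dgmP rf xy.
by rewrite /label /= -sE; move: iD; rewrite /points /=; lia.
Qed.

Lemma level_points x j y : is_level rho x j y ->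
  exists2 u, points (rank_dgm rho) u & u.1 = (x, y) /\ label rho u = j.
Proof.
move=> [xy ja jb].
have [[s ys sE] amax] := count_aboveP xy.
have aj : (count_above rho x y <= j)%N by rewrite -sE ja.
exists ((x, y), (j - count_above rho x y)%N); last first.
  by rewrite /label /= subnKC.
have [[r0 [s0 [xr0 ry0 ys0 DE]]] _] := rank_dgmP rf xy.
have := jb _ xr0 ry0; have := amax _ ys0.
by rewrite /points /=; lia.
Qed.

Lemma level_unique x j y y' : is_level rho x j y -> is_level rho x j y' -> y = y'.
Proof.
wlog yy' : y y' / (y < y')%E => [hw l l'|].
  by case: (ltgtP y y') => // yy'; [|apply/esym]; apply: hw.
move=> [xy ja _] [_ _ jb]; have [t [yt ty]] := ereal_between yy'.
have := ja t%:E (or_introl yt); have := jb _ (lt_trans xy yt) ty.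
by rewrite ltnNge => /negbTE ->.
Qed.

Lemma label_inj u v : points (rank_dgm rho) u -> points (rank_dgm rho) v ->
  u.1.1 = v.1.1 -> label rho u = label rho v -> u = v.
Proof.
move=> /points_level lu /points_level lv xE jE.
rewrite xE jE in lu; have yE := level_unique lu lv.
move: u v xE yE jE {lu lv} => [[x y] i] [[x' y'] i'] /= -> ->.
by rewrite /label /= => /addnI ->.
Qed.

Lemma level_exists x j t : (x < t)%E -> (j < line_count rho x t)%N ->
  exists y, is_level rho x j y.
Proof.
move=> xt jt; pose S := [set r | (x < r)%E /\ (j < line_count rho x r)%N].
exists (ereal_sup S); have tS : (t <= ereal_sup S)%E.
  exact: ereal_sup_ubound.
have xS := lt_le_trans xt tS; split=> // [s ys|r xr].
  rewrite leqNgt; apply/negP => js.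
  have xs : (x < s)%E by exact: lt_le_trans xS (left_of_le ys).
  have Ss : S s by [].
  (* A supremum of [+oo] is allowed, as line counts vanish there. *)
  case: ys => [|[s_oo S_oo]]; first by rewrite ltNge ereal_sup_ubound.
  by move: js xs; rewrite s_oo => /[swap] /(line_count_infty rf) ->.
move=> /ereal_sup_gt[r' [xr' jr'] rr']; apply: leq_trans jr' _.
by apply: line_count_anti => //; exact: ltW.
Qed.

End Levels.

Implicit Types (D : diagram R).

Definition partial_bijection D D'
    (M : ((\bar R * \bar R) * nat) -> ((\bar R * \bar R) * nat) -> Prop) :=
  [/\ forall u v, M u v -> points D u /\ points D' v,
      forall u v v', M u v -> M u v' -> v = v' &
      forall u u' v, M u v -> M u' v -> u = u'].

(** Points on the same vertical line with the same number, counted from the top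
    down, are matched. The hypotheses pass to line counts: those of [rho2] are
    at most those of [rho1], and at least those of [rho1] at heights increased
    by [e]; so the point of [rho2] with a given number is at most [e] below the
    one of [rho1]. *)
Lemma line_matching rho1 rho2 (e : R) :
  rank_function rho1 -> rank_function rho2 ->
  (forall p q t, (p < q)%E -> (q < t)%E ->
    increment rho2 p q t <= increment rho1 p q t) ->
  (forall p q t, (p < q)%E -> (q < t)%E ->
    increment rho1 p q (t + e%:E)%E <= increment rho2 p q t) ->
  0 <= e ->
  exists M, [/\ partial_bijection (rank_dgm rho1) (rank_dgm rho2) M,
    forall u v, M u v -> [/\ u.1.1 = v.1.1, (v.1.2 <= u.1.2)%E &
                                (u.1.2 <= v.1.2 + e%:E)%E],
    forall v, points (rank_dgm rho2) v -> exists u, M u v &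
    forall u, points (rank_dgm rho1) u -> (forall v, ~ M u v) ->
      (u.1.2 <= u.1.1 + e%:E)%E].
Proof.
move=> rf1 rf2 le21 le12 e0.
have right_of_lt p x q : right_of p x -> (x < q)%E -> (p < q)%E.
  by move=> /right_of_le; exact: le_lt_trans.
have count21 x t : (x < t)%E -> (line_count rho2 x t <= line_count rho1 x t)%N.
  move=> xt; have [[p [q [px xq qt E]]] _] := line_countP rf1 xt.
  have [_ /(_ p q px xq qt) h] := line_countP rf2 xt.
  rewrite -lez_nat (le_trans h) // -E le21 //; exact: right_of_lt xq.
have lt_shift t : (t <= t + e%:E)%E by rewrite leeDl ?lee_fin.
have count12 x t : (x < t)%E ->
    (line_count rho1 x (t + e%:E)%E <= line_count rho2 x t)%N.
  move=> xt; have [[p [q [px xq qt E]]] _] := line_countP rf2 xt.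
  have qt' := lt_le_trans qt (lt_shift t).
  have [_ /(_ p q px xq qt') h] := line_countP rf1 (lt_trans xq qt').
  rewrite -lez_nat (le_trans h) // -E le12 //; exact: right_of_lt xq.
exists (fun u v => [/\ points (rank_dgm rho1) u, points (rank_dgm rho2) v,
  u.1.1 = v.1.1 & label rho1 u = label rho2 v]); split.
- split=> [u v []//|u v v' [_ pv xv lv] [_ pv' xv' lv']|u u' v [pu _ xv lv] [pu' _ xv' lv']].
    by apply: (label_inj rf2); rewrite -?xv -?lv.
  by apply: (label_inj rf1); rewrite // ?xv ?lv.
- move=> [[x y1] i1] [[x' y2] i2] [/(points_level rf1) l1 /(points_level rf2) l2].
  move=> /= xE; subst x' => jE; rewrite /= -jE in l1 l2 *.
  (* A height violating one of the inequalities would lie below one of the two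
     points with the same number and above the other. *)
  move: l1 l2 => [xy1 a1 b1] [xy2 a2 b2]; split=> //.
    rewrite leNgt; apply/negP => /ereal_between[t [y1t ty2]].
    have := a1 _ (or_introl y1t); have xt := lt_trans xy1 y1t.
    by rewrite leqNgt (leq_trans (b2 _ xt ty2)) ?count21.
  rewrite leNgt; apply/negP => /ereal_between[t [y2t ty1]].
  have y2t' : (y2 < (t - e)%:E)%E.
    by move: y2t; rewrite EFinB lteBrDr.
  have xt := lt_trans xy2 y2t'.
  have := a2 _ (or_introl y2t'); rewrite leqNgt => /negP; apply.
  have := count12 _ _ xt; rewrite -EFinD subrK.
  by apply: leq_trans; apply: b1 => //; rewrite (lt_le_trans xt) // lee_fin gerBl.
- move=> [[x y2] i2] pv; have [xy2 a2 b2] := points_level rf2 pv.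
  have [r [xr ry]] := ereal_between xy2.
  have [y1 /(level_points rf1)[u pu [uE lu]]] :=
    level_exists rf1 xr (leq_trans (b2 _ xr ry) (count21 _ _ xr)).
  by exists u; split=> //; rewrite uE.
- move=> [[x y1] i1] pu nM; have [/= xy1 a1 b1] := points_level rf1 pu.
  rewrite leNgt; apply/negP => /ereal_between[t [xt ty1]].
  have xt' : (x < (t - e)%:E)%E by move: xt; rewrite EFinB lteBrDr.
  have xt1 : (x < t%:E)%E by rewrite (lt_le_trans xt') // lee_fin gerBl.
  have := count12 _ _ xt'; rewrite -EFinD subrK => h.
  have [y2 /(level_points rf2)[v pv [vE lv]]] :=
    level_exists rf2 xt' (leq_trans (b1 _ xt1 ty1) h).
  by apply: (nM v); split=> //; rewrite vE.
Qed.

(** The rank function of the module over the reversed real line, for which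
    births and deaths are exchanged. *)
Definition reversed rho p q : int := rho (- q)%E (- p)%E.

Definition flip (u : (\bar R * \bar R) * nat) : (\bar R * \bar R) * nat :=
  ((- u.1.2, - u.1.1)%E, u.2).

Lemma flipK : involutive flip.
Proof. by move=> [[x y] i]; rewrite /flip /= !oppeK. Qed.

Lemma reversed_mu rho p q r s :
  rank_mu (reversed rho) p q r s = rank_mu rho (- s)%E (- r)%E (- q)%E (- p)%E.
Proof. by rewrite /rank_mu /reversed; lia. Qed.

Lemma reversed_rank_function rho : rank_function rho -> rank_function (reversed rho).
Proof.
move=> rf; split=> [p q r s pq qr rs|p|t].
- by rewrite reversed_mu; apply: rank_mu_ge0 => //; rewrite lteN2.
- by rewrite /reversed /= rank_left_infty.
- by rewrite /reversed /= rank_right_infty.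
Qed.

Lemma right_ofN p x : right_of p x -> left_of (- x)%E (- p)%E.
Proof. by case=> [h|[-> ->]]; [left; rewrite lteN2|right]. Qed.

Lemma left_ofN y s : left_of y s -> right_of (- s)%E (- y)%E.
Proof. by case=> [h|[-> ->]]; [left; rewrite lteN2|right]. Qed.

Lemma reversed_dgm rho u :
  points (rank_dgm (reversed rho)) u <-> points (rank_dgm rho) (flip u).
Proof.
suff E : mu_at (reversed rho) u.1 = mu_at rho (flip u).1.
  by rewrite /points /rank_dgm /= lteN2 E.
apply/seteqP; split=> m [p [q [r [s [[/= px xq qr ry ys] ->]]]]];
  exists (- s)%E, (- r)%E, (- q)%E, (- p)%E; rewrite ?reversed_mu ?oppeK; split=> //;
  split; rewrite /= ?lteN2 //.
- exact: left_ofN.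
- exact: right_ofN.
- by rewrite -(oppeK u.1.1); exact: left_ofN.
- by rewrite lteNr.
- by rewrite lteNl.
- by rewrite -(oppeK u.1.2); exact: right_ofN.
Qed.

(** The one-sided closeness of the diagrams of the source and of the target of a
    morphism with [e]-trivial kernel and cokernel. *)
Definition shift_matched (e : R) D D' :=
  exists M, [/\ partial_bijection D D' M,
    forall u v, M u v -> [/\ (v.1.1 <= u.1.1)%E, (u.1.1 <= v.1.1 + e%:E)%E,
      (v.1.2 <= u.1.2)%E & (u.1.2 <= v.1.2 + e%:E)%E],
    forall u, points D u -> (forall v, ~ M u v) -> (u.1.2 <= u.1.1 + e%:E)%E &
    forall v, points D' v -> (forall u, ~ M u v) -> (v.1.2 <= v.1.1 + e%:E)%E].

(** In the application, [rhoI] is the rank function of the image of a morphism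
    from a module with rank function [rhoV] to one with [rhoU]. Passing to the
    image moves deaths only and the inclusion of the image moves births only,
    so the two matchings of vertical and of horizontal lines compose. *)
Lemma image_matching rhoV rhoI rhoU (e : R) :
  rank_function rhoV -> rank_function rhoI -> rank_function rhoU -> 0 <= e ->
  (forall p q t, (p < q)%E -> (q < t)%E ->
    increment rhoI p q t <= increment rhoV p q t) ->
  (forall p q t, (p < q)%E -> (q < t)%E ->
    increment rhoV p q (t + e%:E)%E <= increment rhoI p q t) ->
  (forall s t t', (s < t)%E -> (t < t')%E ->
    rhoI s t - rhoI s t' <= rhoU s t - rhoU s t') ->
  (forall s t t', (s < t)%E -> (t < t')%E ->
    rhoU (s - e%:E)%E t - rhoU (s - e%:E)%E t' <= rhoI s t - rhoI s t') ->
  shift_matched e (rank_dgm rhoV) (rank_dgm rhoU).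
Proof.
move=> rfV rfI rfU e0 IV VI IU UI.
have [M1 [[pts1 fun1 inj1] close1 all1 short1]] := line_matching rfV rfI IV VI e0.
have [p q t pq qt|p q t pq qt|//|M2 [[pts2 fun2 inj2] close2 all2 short2]] :=
  @line_matching (reversed rhoU) (reversed rhoI) e
    (reversed_rank_function rfU) (reversed_rank_function rfI).
- by apply: IU; rewrite lteN2.
- by rewrite /increment /reversed fin_num_oppeD //; apply: UI; rewrite lteN2.
exists (fun u w => exists2 v, M1 u v & M2 (flip w) (flip v)); split.
- split=> [u w [v /pts1[pu _] /pts2[/reversed_dgm]]|u w w'|u u' w].
  + by rewrite flipK.
  + move=> [v uv vw] [v' uv' vw']; have vv' := fun1 _ _ _ uv uv'; subst v'.
    by rewrite -(flipK w) -(flipK w') (inj2 _ _ _ vw vw').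
  + move=> [v uv vw] [v' uv' vw'].
    have /(congr1 flip) := fun2 _ _ _ vw vw'; rewrite !flipK => vv'; subst v'.
    exact: inj1 uv uv'.
- move=> u w [v /close1[xE yv vy] /close2[/= yE xw wx]].
  have {}yE : v.1.2 = w.1.2 by rewrite -(oppeK v.1.2) -yE oppeK.
  rewrite xE -yE; split=> //.
    by move: xw; rewrite leeN2.
  by rewrite -leeN2 fin_num_oppeD // leeBlDr.
- move=> u pu nM; apply: short1 => // v uv; have [_ pv] := pts1 _ _ uv.
  have [|w vw] := all2 (flip v); first by apply/reversed_dgm; rewrite flipK.
  by apply: (nM (flip w)); exists v => //; rewrite flipK.
- move=> w pw nM; rewrite -leeN2 fin_num_oppeD // leeBlDr //.
  apply: (short2 (flip w)) => [|v wv]; first by apply/reversed_dgm; rewrite flipK.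
  have [_ /reversed_dgm pv] := pts2 _ _ wv; have [u uv] := all1 _ pv.
  by apply: (nM u); exists (flip v) => //; rewrite flipK.
Qed.

End RankFunctions.

(** * Pushing chains along a retraction of vertices *)

(** The contiguity of [r] with the identity of [K], in a form that permits moving
    one vertex of a simplex at a time. *)
Definition vertex_retraction (T : choiceType) (K : scomplex T) (A : set T)
    (r : T -> T) :=
  forall sigma v, simplex K sigma -> sigma v -> ~ A v ->
    A (r v) /\ simplex K (sigma `|` [set r v]).

Section Chains.
Variables (k : fieldType) (T : choiceType).
Implicit Types (c d : seq T -> k^o) (K : scomplex T) (s t : seq T) (v w : T).

(** Chains of the full simplex on [T], where the empty simplex is allowed. *)
Definition alternating c :=
  [/\ finite_set [set s | c s != 0], forall s, ~~ uniq s -> c s = 0 &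
    forall s x y t, c (s ++ x :: y :: t) = - c (s ++ y :: x :: t)].

(** The boundary operator of the augmented chain complex. *)
Definition augmented_boundary c : seq T -> k^o :=
  fun s => \sum_(v \in [set: T]) c (v :: s).

Definition contract v c : seq T -> k^o := fun s => c (v :: s).

(** The join [w * c] with the vertex [w], which is zero on simplices that
    contain [w]; the sign moves [w] to the front of the sequence. *)
Definition cone w c : seq T -> k^o := fun s =>
  if uniq s && (w \in s) then (-1) ^+ index w s * (c (rem w s) : k) else 0.

Lemma chain_alternating K c : is_chain K c -> alternating c.
Proof. by case. Qed.

Lemma chain_nil K c : is_chain K c -> c [::] = 0.
Proof.
move=> [_ cK _ _]; apply/eqP/negPn/negP => /cK/simplex_neq0[x].
by rewrite /= in_nil.
Qed.

Lemma boundaryE c s : s != [::] -> boundary c s = augmented_boundary c s.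
Proof. by case: s. Qed.

Lemma alternating_move c p s w t : alternating c ->
  c (p ++ w :: s ++ t) = (-1) ^+ size s * (c (p ++ s ++ w :: t) : k).
Proof.
move=> [_ _ ca]; elim: s p => [|x s IH] p /=; first by rewrite mul1r.
by rewrite ca -cat_rcons IH cat_rcons exprS mulN1r mulNr.
Qed.

Lemma alternating_rem c w s : alternating c -> w \in s ->
  c (w :: rem w s) = (-1) ^+ index w s * (c s : k).
Proof.
move=> ca ws.
have E : take (index w s) s ++ w :: drop (index w s).+1 s = s.
  by rewrite -{2}(nth_index w ws) -drop_nth ?index_mem // cat_take_drop.
have := @alternating_move c [::] (take (index w s) s) w (drop (index w s).+1 s) ca.
by rewrite /= E size_takel ?index_size // remE.
Qed.

Lemma finite_cons c s : alternating c -> finite_set [set v | c (v :: s) != 0].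
Proof.
move=> [cf _ _]; have inj : injective (fun v : T => v :: s) by move=> ? ? [].
exact: (@finite_preimage _ _ _ (fun v : T => v :: s) (in2W inj) cf).
Qed.

Lemma alternating_contract v c : alternating c -> alternating (contract v c).
Proof.
move=> [cf cu ca]; split=> [|s su|s x y t].
- have inj : injective (cons v) by move=> ? ? [].
  exact: (@finite_preimage _ _ _ (cons v) (in2W inj) cf).
- by apply: cu; rewrite /= negb_and su orbT.
- exact: (ca (v :: s)).
Qed.

Lemma cone_neq0 w c s : cone w c s != 0 ->
  [/\ uniq s, w \in s & c (rem w s) != 0].
Proof.
rewrite /cone; case: ifP => [/andP[us ws]|]; last by rewrite eqxx.
by rewrite mulf_eq0 negb_or => /andP[_].
Qed.

Lemma rem_cat w s t :
  rem w (s ++ t) = if w \in s then rem w s ++ t else s ++ rem w t.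
Proof.
elim: s => //= x s IH; rewrite inE eq_sym; case: eqVneq => //= _.
by rewrite IH; case: ifP.
Qed.

Lemma alternating_cone w c : alternating c -> alternating (cone w c).
Proof.
move=> [cf cu ca]; split=> [|s su|s x y t].
- have : finite_set (\bigcup_(t in [set t | c t != 0])
      [set` permutations (w :: t)]) by apply: bigcup_finite => // t _; exact: finite_seq.
  apply: sub_finite_set => s /= /cone_neq0[us ws cs]; exists (rem w s) => //=.
  by rewrite mem_permutations; exact: perm_to_rem.
- by rewrite /cone (negbTE su).
have P : perm_eq (s ++ x :: y :: t) (s ++ y :: x :: t).
  by rewrite perm_cat2l (perm_catCA [:: x] [:: y]).
rewrite /cone (perm_uniq P) (perm_mem P).
case: ifPn => [/andP[us _]|_]; last by rewrite oppr0.
have sxy : x != y.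
  move: us; rewrite cat_uniq => /and3P[_ _ /= /andP[+ _]].
  by rewrite inE negb_or eq_sym => /andP[].
rewrite !rem_cat !index_cat; case: ifP => ws.
  by rewrite ca mulrN.
rewrite /=; have [xw|xw] := eqVneq x w.
  have /negbTE -> : y != w by apply: contraNneq sxy => ->; rewrite xw.
  by rewrite addn0 addn1 exprS mulN1r mulNr opprK.
have [_|yw] := eqVneq y w.
  by rewrite addn0 addn1 exprS mulN1r mulNr.
by rewrite ca mulrN.
Qed.

Lemma alternatingB c d : alternating c -> alternating d ->
  alternating (fun s => c s - d s : k^o).
Proof.
move=> [cf cu ca] [df du da]; split=> [|s su|s x y t].
- have cdf : finite_set ([set s | c s != 0] `|` [set s | d s != 0]).
    by rewrite finite_setU.
  apply: sub_finite_set cdf => s /=; have [->|c0] := eqVneq (c s) 0.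
    by rewrite sub0r oppr_eq0; right.
  by left.
- by rewrite cu // du // subr0.
- by rewrite ca da opprB opprK addrC.
Qed.

Lemma augmented_boundaryB c d s : alternating c -> alternating d ->
  augmented_boundary (fun s => c s - d s : k^o) s =
  augmented_boundary c s - augmented_boundary d s.
Proof.
move=> ca da.
have fcd : finite_set ([set v | c (v :: s) != 0] `|` [set v | d (v :: s) != 0]).
  by rewrite finite_setU; split; exact: finite_cons.
have [r E] := (finite_seqP _).1 fcd.
have out v : v \notin undup r -> c (v :: s) = 0 /\ d (v :: s) = 0.
  rewrite mem_undup => vr.
  have nv : ~ ([set v | c (v :: s) != 0] `|` [set v | d (v :: s) != 0]) v.
    by rewrite E /=; apply/negP.
  by split; apply/eqP/negPn/negP => ?; apply: nv; [left|right].
rewrite /augmented_boundary !(@fsum_undup _ _ r) => [|v /out[]//|v /out[]//|v /out[-> ->]].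
  by rewrite sumrB.
by rewrite subr0.
Qed.

Lemma augmented_boundary_contract v c s : alternating c ->
  augmented_boundary (contract v c) s = - augmented_boundary c (v :: s).
Proof.
move=> ca; have [r E] := (finite_seqP _).1 (finite_cons (v :: s) ca).
have out u : u \notin undup r -> c (u :: v :: s) = 0.
  rewrite mem_undup => ur; apply/eqP/negPn/negP => cu.
  have : [set u | c (u :: v :: s) != 0] u by [].
  by rewrite E /= (negbTE ur).
have swap u : contract v c (u :: s) = - c (u :: v :: s).
  by have [_ _ ca0] := ca; exact: (ca0 [::]).
rewrite /augmented_boundary !(@fsum_undup _ _ r) // => [|u /out cu].
  by rewrite -sumrN; apply: eq_bigr.
by rewrite swap cu oppr0.
Qed.

(** The join with [w] is a contracting homotopy of the augmented complex of the
    full simplex. The empty simplex gives the formula for vertices as well. *)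
Lemma augmented_boundary_cone w c s : alternating c ->
  augmented_boundary (cone w c) s = c s - cone w (augmented_boundary c) s.
Proof.
move=> ca; have [_ cu _] := ca; apply/eqP; rewrite eq_sym subr_eq eq_sym; apply/eqP.
have [us|nus] := boolP (uniq s); last first.
  rewrite cu // {2}/cone (negbTE nus) addr0.
  rewrite /augmented_boundary fsbig1 // => v _.
  by rewrite /cone /= (negbTE nus) andbF.
have [ws|ws] := boolP (w \in s); last first.
  rewrite {2}/cone (negbTE ws) andbF addr0.
  rewrite /augmented_boundary (@fsum_undup _ _ [:: w]) ?big_seq1 => [|v].
    by rewrite /cone /= ws us mem_head eqxx mul1r.
  rewrite /= inE => vw; rewrite /cone inE (negbTE ws) orbF eq_sym.
  by rewrite (negbTE vw) andbF.
have [r E] := (finite_seqP _).1 (finite_cons (rem w s) ca).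
have out v : v \notin undup (w :: r) -> c (v :: rem w s) = 0.
  rewrite mem_undup inE negb_or => /andP[_ vr]; apply/eqP/negPn/negP => cv.
  have : [set v | c (v :: rem w s) != 0] v by [].
  by rewrite E /= (negbTE vr).
have term v : cone w c (v :: s) + (-1) ^+ index w s * (c (v :: rem w s) : k)
    = if v == w then c s else 0.
  rewrite /cone /= us andbT; have [->|vw] := eqVneq v w.
    by rewrite ws /= add0r (alternating_rem ca ws) mulrA -expr2 sqrr_sign mul1r.
  rewrite inE ws orbT andbT; case: ifPn => [vs|/negPn vs].
    by rewrite exprS mulN1r mulNr addNr.
  rewrite add0r cu ?mulr0 //= negb_and negbK mem_rem_uniq // inE vw vs //.
rewrite {2}/cone us ws /= /augmented_boundary !(@fsum_undup _ _ (w :: r)) //; last first.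
  by move=> v /[dup] /out c0; rewrite mem_undup inE negb_or => /andP[vw _];
    have := term v; rewrite c0 mulr0 addr0 (negbTE vw).
rewrite mulr_sumr -big_split /= (eq_bigr _ (fun v _ => term v)) -big_mkcond.
rewrite -big_filter.
have -> : [seq v <- undup (w :: r) | v == w] = [:: w].
  by rewrite filter_pred1_uniq ?undup_uniq // mem_undup mem_head.
by rewrite big_seq1.
Qed.

Lemma cone_contract v c s : alternating c ->
  cone v (contract v c) s = if v \in s then c s else 0.
Proof.
move=> ca; rewrite /cone; have [us|us] := boolP (uniq s); last first.
  by case: ca => _ cu _; rewrite /= cu // if_same.
rewrite /=; case: ifP => // vs.
by rewrite /contract (alternating_rem ca vs) mulrA -expr2 sqrr_sign mul1r.
Qed.

Lemma cone0 w c s : (forall t, c t = 0) -> cone w c s = 0.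
Proof. by move=> c0; rewrite /cone c0 mulr0 if_same. Qed.

(** With [c = v * a + b], where [a] and [b] do not involve [v], this is
    [w * a + b]; the homotopy to the identity is [w * v * a]. *)
Definition move_vertex v w c : seq T -> k^o := fun s =>
  c s - (cone v (contract v c) s - cone w (contract v c) s).

Definition move_homotopy v w c : seq T -> k^o := cone w (cone v (contract v c)).

Lemma alternating_move_vertex v w c :
  alternating c -> alternating (move_vertex v w c).
Proof.
move=> ca; have va := alternating_contract v ca.
by apply: alternatingB => //; apply: alternatingB; exact: alternating_cone.
Qed.

Lemma alternating_move_homotopy v w c :
  alternating c -> alternating (move_homotopy v w c).
Proof. by move=> ca; do 2 apply: alternating_cone; exact: alternating_contract. Qed.

Section Move.
Variables (v w : T) (c : seq T -> k^o).
Hypotheses (ca : alternating c) (vc : forall s, augmented_boundary c (v :: s) = 0).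

Let va : alternating (contract v c). Proof. exact: alternating_contract. Qed.

Let boundary_va s : augmented_boundary (contract v c) s = 0.
Proof. by rewrite augmented_boundary_contract // vc oppr0. Qed.

Let boundary_cone_va u s : augmented_boundary (cone u (contract v c)) s = contract v c s.
Proof. by rewrite augmented_boundary_cone // cone0 ?subr0. Qed.

Lemma boundary_move_vertex s :
  augmented_boundary (move_vertex v w c) s = augmented_boundary c s.
Proof.
have caa u := alternating_cone u va.
rewrite augmented_boundaryB //; last exact: alternatingB.
by rewrite augmented_boundaryB // !boundary_cone_va subrr subr0.
Qed.

Lemma boundary_move_homotopy s :
  augmented_boundary (move_homotopy v w c) s = c s - move_vertex v w c s.
Proof.
rewrite augmented_boundary_cone; last exact: alternating_cone.
have -> : augmented_boundary (cone v (contract v c)) = contract v c.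
  by apply/funext => t; exact: boundary_cone_va.
by rewrite /move_vertex opprB addrCA subrr addr0.
Qed.

End Move.

(** The vertices of [c] outside [A] are moved to their images under [r] one at a
    time. The boundary of [c] does not contain them, so it is not affected, and
    the difference of [c] and the resulting chain is a boundary. *)
Lemma retract_chain K (A : set T) (r : T -> T) :
  vertex_retraction K A r -> forall c, is_chain K c ->
  (forall s, boundary c s != 0 -> [set` s] `<=` A) ->
  exists c' d, [/\ is_chain K c', is_chain K d,
    forall s, c' s != 0 -> [set` s] `<=` A,
    boundary c' = boundary c & c = c' + boundary d].
Proof.
move=> rK c Kc cA; have [cf _ _ _] := Kc.
have [l lE] := (finite_seqP _).1 cf.
have : forall s v, c s != 0 -> v \in s -> A v \/ v \in flatten l.
  move=> s v cs vs; right; apply/flattenP; exists s => //.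
  by have : [set s | c s != 0] s by []; rewrite lE.
move: (flatten l) => {l cf lE}l0; elim: l0 c Kc cA => [|v l IH] c Kc cA cl.
  exists c, 0; split=> //; first exact: is_chain0.
    by move=> s cs v /= /(cl _ _ cs)[].
  rewrite (_ : boundary 0 = 0) ?addr0 //.
  by apply/funext => -[|w s] //=; rewrite fsbig1.
have [Av|nAv] := pselect (A v).
  by apply: IH => // s u cs us; case: (cl s u cs us) => [|]; [left|rewrite inE => /predU1P[->|]; [left|right]].
(* The image [r v] is known to be in [A] only if [v] is in a simplex of [K]. *)
have [[s0 [cs0 vs0]]|nv] := pselect (exists s, c s != 0 /\ v \in s); last first.
  apply: IH => // s u cs us; case: (cl s u cs us) => [|]; [by left|].
  rewrite inE => /predU1P[uv|]; [|by right].
  by case: nv; exists s; rewrite -uv.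
have [_ cK cu _] := Kc; have ca := chain_alternating Kc.
have [Aw _] := rK _ v (cK _ cs0) vs0 nAv; pose w := r v.
have vw : v != w by apply/eqP => vw; apply: nAv; rewrite vw.
have bv s : augmented_boundary c (v :: s) = 0.
  apply/eqP/negPn/negP => h; apply: nAv.
  by apply: (cA (v :: s)) => //=; rewrite mem_head.
have supp s : move_vertex v w c s != 0 -> (c s != 0 /\ v \notin s) \/
    [/\ w \in s, v \notin s & c (v :: rem w s) != 0].
  rewrite /move_vertex cone_contract //.
  have [->|/cone_neq0[us ws cs]] := eqVneq (cone w (contract v c) s) 0.
    by case: ifP => vs; rewrite !subr0 ?subrr ?eqxx // => ?; left.
  move=> _; right; split=> //; apply/negP => vs.
  move/eqP: cs; apply; apply: cu; rewrite /= negb_and negbK.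
  by rewrite mem_rem_uniq // inE vw vs.
have cu' s : [set` s] `<=` [set` v :: rem w s] `|` [set w].
  move=> u /=; have [->|uw] := eqVneq u w; first by right.
  by move=> us; left; rewrite /= inE; apply/orP; right; rewrite rem_mem.
have Kc1 : is_chain K (move_vertex v w c).
  have [? ? ?] := alternating_move_vertex v w ca; split=> // s /supp[[/cK//]|].
  move=> [ws _ /cK Ks]; have [|_ ] := rK _ v Ks _ nAv; first by rewrite /= mem_head.
  by move/simplex_face; apply; [exact: cu'|exists w].
have Kd1 : is_chain K (move_homotopy v w c).
  have [? ? ?] := alternating_move_homotopy v w ca; split=> // s.
  move=> /cone_neq0[us ws]; rewrite cone_contract //.
  case: ifP => vs; last by rewrite eqxx.
  move=> /cK Ks; have [//|_] := rK _ v Ks _ nAv.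
  move/simplex_face; apply; last by exists w.
  move=> u /=; have [->|uw] := eqVneq u w; first by right.
  by move=> us'; left; rewrite /= rem_mem.
have b1 : boundary (move_vertex v w c) = boundary c.
  apply/funext => -[//|u s]; rewrite !boundaryE //; exact: boundary_move_vertex.
have h1 : c = move_vertex v w c + boundary (move_homotopy v w c).
  apply/funext => -[|u s].
    by rewrite /GRing.add /= (chain_nil Kc) (chain_nil Kc1) addr0.
  rewrite /GRing.add /= -/(augmented_boundary _ (u :: s)).
  by rewrite boundary_move_homotopy // addrC subrK.
have [||c' [d [Kc' Kd c'A bE E]]] := IH _ Kc1.
- by rewrite b1.
- move=> s u /supp[[cs vs]|[ws vs cs]] us.
    case: (cl s u cs us) => [|]; [by left|rewrite inE => /predU1P[uv|]; last by right].
    by rewrite -uv us in vs.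
  have [->|uw] := eqVneq u w; first by left.
  have [||] := cl _ u cs; first by rewrite inE rem_mem ?orbT.
    by left.
  rewrite inE => /predU1P[uv|]; last by right.
  by rewrite -uv us in vs.
exists c', (1 *: d + move_homotopy v w c); split=> //.
- exact: is_chain_linear.
- by rewrite bE.
- by rewrite (boundary_linear _ Kd Kd1) scale1r addrA -E.
Qed.

End Chains.

(** * Morphisms of persistence modules *)

Section Interior.
Variable R : realType.
Implicit Types (x p q : \bar R).

Lemma nbhs_ereal_itv x p q : (p < q)%E ->
  nbhs x [set` `[p, q]] <-> right_of p x /\ left_of x q.
Proof.
move=> pq; split=> [xn|[px xq]].
- have := nbhs_singleton xn; rewrite /= in_itv /= => /andP[px xq].
  split.
    move: px; rewrite le_eqVlt => /predU1P[px|]; last by left.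
    case: p => [p||] in px pq xn *; subst x.
    + have : nbhs (p : R) [set y : R | [set` `[p%:E, q]] y%:E] by exact: xn.
      move=> /nbhs_ballP[e /= e0 /(_ (p - e / 2))].
      have e2 : 0 < e / 2 by rewrite divr_gt0.
      rewrite /ball /= in_itv /= => /(_ _)/andP[].
        rewrite opprB addrC subrK gtr0_norm //.
        by rewrite gtr_pMr // invf_lt1 // ltr1n.
      by rewrite lee_fin leNgt ltrBlDr ltrDl e2.
    + by move: pq; rewrite ltNge leey.
    + by right.
  move: xq; rewrite le_eqVlt => /predU1P[xq|]; last by left.
  case: q => [q||] in xq pq xn px *; subst x.
  + have : nbhs (q : R) [set y : R | [set` `[p, q%:E]] y%:E] by exact: xn.
    move=> /nbhs_ballP[e /= e0 /(_ (q + e / 2))].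
    have e2 : 0 < e / 2 by rewrite divr_gt0.
    rewrite /ball /= in_itv /= => /(_ _)/andP[].
      rewrite opprD addrA subrr add0r normrN gtr0_norm //.
      by rewrite gtr_pMr // invf_lt1 // ltr1n.
    by move=> _; rewrite lee_fin leNgt ltrDl e2.
  + by right.
  + by move: pq; rewrite ltNge leNye.
- have xp : nbhs x [set y | (p <= y)%E].
    case: px => [px|[-> _]].
      by apply: filterS (open_ereal_gt' px) => y /ltW.
    by apply: filterE => y /=; exact: leNye.
  have {}xq : nbhs x [set y | (y <= q)%E].
    case: xq => [xq|[-> _]].
      by apply: filterS (open_ereal_lt' xq) => y /ltW.
    by apply: filterE => y /=; exact: leey.
  apply: filterS (filterI xp xq) => y /= [py yq].
  by rewrite in_itv /= py yq.
Qed.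

(** As [q < r] in the definition of the measure, the sides [q] and [r] of a
    rectangle are never at infinity, so only [p] and [s] can be attained in the
    interior relative to the extended plane. *)
Lemma dgm_rank_dgm (k : fieldType) (V : persmod k R) :
  dgm V = rank_dgm (pm_rank V).
Proof.
apply/funext => z; rewrite /dgm /rank_dgm.
suff -> : pm_mu_at V z = mu_at (pm_rank V) z by [].
apply/seteqP; split=> m [p [q [r [s]]]].
- move=> [pq qr rs zn ->]; exists p, q, r, s; split=> //.
  have [[A B] /= [nA nB] AB] : nbhs z ([set` `[p, q]] `*` [set` `[r, s]]) by [].
  have /(nbhs_ereal_itv _ pq)[px xq] : nbhs z.1 [set` `[p, q]].
    apply: filterS nA => x Ax; have [] // := AB (x, z.2).
    by split=> //; exact: nbhs_singleton.
  have /(nbhs_ereal_itv _ rs)[ry ys] : nbhs z.2 [set` `[r, s]].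
    apply: filterS nB => y By; have [] // := AB (z.1, y).
    by split=> //; exact: nbhs_singleton.
  split=> //.
    by case: xq => // -[q_oo _]; move: qr; rewrite q_oo ltNge leey.
  by case: ry => // -[r_oo _]; move: qr; rewrite r_oo ltNge leNye.
- move=> [[px xq qr ry ys] ->]; exists p, q, r, s.
  have pq := le_lt_trans (right_of_le px) xq.
  have rs := lt_le_trans ry (left_of_le ys).
  split=> //; exists ([set` `[p, q]], [set` `[r, s]]) => //=.
  by split; apply/nbhs_ereal_itv => //; split=> //; left.
Qed.

End Interior.

Section Morphism.
Variables (k : fieldType) (R : realType).
Implicit Types (V U : persmod k R).

(** The image in [V t] of the part of [V] born at [a] or before. *)
Definition image_set V (a : \bar R) (t : R) : set (V t) :=
  if a is a'%:E then
    if pselect (a' <= t) is left h then range (pm_map V h) else [set 0]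
  else [set 0].

Arguments image_set : clear implicits.

Lemma subspace_image_set V a t : is_subspace (image_set V a t).
Proof.
case: a => [a||] /=; try exact: subspace0.
by case: pselect => h; [exact: subspace_range|exact: subspace0].
Qed.

Lemma image_setE {V} (a t : R) (h : a <= t) :
  image_set V a%:E t = range (pm_map V h).
Proof.
rewrite /=; case: pselect => // h'.
by rewrite (Prop_irrelevance h' h).
Qed.

Lemma image_set_mono {V} p q t : (p <= q)%E -> (q <= t%:E)%E ->
  image_set V p t `<=` image_set V q t.
Proof.
case: p => [p||] pq qt; last first.
- by move=> _ ->; have [] := subspace_image_set V q t.
- by move: (le_trans pq qt); rewrite leNgt ltry.
case: q => [q||] in pq qt *; last 2 first.
- by move: qt; rewrite leNgt ltry.
- by move: pq; rewrite leNgt ltNyr.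
rewrite !lee_fin in pq qt.
rewrite (image_setE (le_trans pq qt)) (image_setE qt) => _ [x _ <-].
by exists (pm_map V pq x) => //; rewrite (pm_comp pq qt (le_trans pq qt)).
Qed.

Lemma image_set_map {V} a t t' (h : t <= t') : (a <= t%:E)%E ->
  pm_map V h @` image_set V a t = image_set V a t'.
Proof.
case: a => [a||] at_; last first.
- by rewrite /= image_set1 linear0.
- by move: at_; rewrite leNgt ltry.
rewrite lee_fin in at_.
rewrite (image_setE at_) (image_setE (le_trans at_ h)).
apply/seteqP; split=> [_ [_ [x _ <-] <-]|_ [x _ <-]].
  by exists x => //; rewrite (pm_comp at_ h (le_trans at_ h)).
exists (pm_map V at_ x); first by exists x.
by rewrite (pm_comp at_ h (le_trans at_ h)).
Qed.

Lemma image_set_finite V a t : q_tame V -> (a < t%:E)%E ->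
  exists n, has_dim (image_set V a t) n.
Proof.
move=> qV; case: a => [a||] at_; last first.
- by exists 0%N; exact: has_dim0.
- by move: at_; rewrite ltNge leey.
rewrite lte_fin in at_.
have [n hn] := qV _ _ (ltW at_) at_; exists n.
by rewrite (image_setE (ltW at_)); exact: hn.
Qed.

Lemma dim_quotient_leE (E W1 W2 : lmodType k) (g : {linear E -> W1})
    (h : {linear E -> W2}) (A B : set E) :
  is_subspace A -> is_subspace B -> B `<=` A -> (exists n, has_dim A n) ->
  (forall x, A x -> h x = 0 -> g x = 0) ->
  (set_dim (g @` A) + set_dim (h @` B) <= set_dim (h @` A) + set_dim (g @` B))%N.
Proof.
move=> sA sB BA [n An] hg; have [m Bm] := has_dim_sub An BA.
have [n1 gA] := has_dim_image g An; have [n2 hA] := has_dim_image h An.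
have [m1 gB] := has_dim_image g Bm; have [m2 hB] := has_dim_image h Bm.
rewrite (set_dimE gA) (set_dimE hA) (set_dimE gB) (set_dimE hB).
exact: dim_quotient_le hA hB gA gB.
Qed.

Lemma image_idfun (T : Type) (A : set T) : idfun @` A = A.
Proof. exact: image_id. Qed.

Definition module_morphism V U (h : forall a, {linear V a -> U a}) :=
  forall a b (hab : a <= b) x, h b (pm_map V hab x) = pm_map U hab (h a x).

Definition image_rank V U (h : forall a, {linear V a -> U a}) (a b : \bar R) : int :=
  if b is b'%:E then (set_dim (h b' @` image_set V a b'))%:Z else 0.

Lemma pm_rankE V :
  pm_rank V = image_rank (fun a : R => idfun : {linear V a -> V a}).
Proof.
apply/funext => a; apply/funext => b.
have d0 t : set_dim [set (0 : V t)] = 0%N by apply: set_dimE; exact: has_dim0.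
case: b => [b||]; case: a => [a||] //=; rewrite image_idfun ?d0 //.
by case: pselect => // h; rewrite d0.
Qed.

Lemma dim_le_diff (a b c d : nat) :
  (a + b <= c + d)%N -> a%:Z - d%:Z <= c%:Z - b%:Z.
Proof. by lia. Qed.

Lemma rank_muE (rho : \bar R -> \bar R -> int) p q r s :
  rank_mu rho p q r s = (rho q r - rho p r) - (rho q s - rho p s).
Proof. by rewrite /rank_mu; lia. Qed.

Section Image.
Variables (V U : persmod k R) (h : forall a, {linear V a -> U a}).
Arguments h : clear implicits.
Hypotheses (hM : module_morphism h) (qV : q_tame V).

Lemma subspace_himage a t : is_subspace (h t @` image_set V a t).
Proof. exact/subspace_image/subspace_image_set. Qed.

Lemma himage_sub a t : (a <= t%:E)%E ->
  h t @` image_set V a t `<=` image_set U a t.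
Proof.
case: a => [a||] at_ _ [x + <-]; last first.
- by move=> ->; rewrite linear0.
- by move: at_; rewrite leNgt ltry.
rewrite lee_fin in at_; rewrite !(image_setE at_) => -[y _ <-].
by exists (h a y) => //; rewrite hM.
Qed.

Lemma himage_map a t t' (tt' : t <= t') : (a <= t%:E)%E ->
  pm_map U tt' @` (h t @` image_set V a t) = h t' @` image_set V a t'.
Proof.
move=> at_; rewrite -(image_set_map tt' at_).
apply/seteqP; split=> [_ [_ [x Ax <-] <-]|_ [_ [x Ax <-] <-]].
  by exists (pm_map V tt' x); [exists x|exact: hM].
by exists (h t x); [exists x|rewrite hM].
Qed.

(** Ranks with a later second argument [s] are dimensions of images under one
    linear map, which is zero for [s = +oo]; this lets infinite rectangles be
    treated like finite ones. *)
Lemma later_rank (t : R) (s : \bar R) : (t%:E < s)%E ->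
  exists (W : lmodType k) (g : {linear U t -> W}), forall a, (a <= t%:E)%E ->
    (set_dim (g @` image_set U a t))%:Z = pm_rank U a s /\
    (set_dim (g @` (h t @` image_set V a t)))%:Z = image_rank h a s.
Proof.
case: s => [s||] // ts.
  rewrite lte_fin in ts; exists (U s), (pm_map U (ltW ts)) => a at_.
  by rewrite pm_rankE /= image_idfun !himage_map // image_set_map.
have im0 (A : set (U t)) : A 0 -> set_dim ((\0 : {linear U t -> U t}) @` A) = 0%N.
  move=> A0; apply: set_dimE.
  rewrite (_ : _ @` A = [set 0]); first exact: has_dim0.
  by apply/seteqP; split=> [_ [x _ <-]//|_ ->]; exists 0.
exists (U t), (\0) => a at_; rewrite !im0; first by case: a {at_}.
- by have [] := subspace_himage a t.
- by have [] := subspace_image_set U a t.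
Qed.

Lemma himage_finite a t : (a < t%:E)%E ->
  exists n, has_dim (h t @` image_set V a t) n.
Proof.
by move=> /(image_set_finite qV)[n]; exact: has_dim_image.
Qed.

Lemma image_rank_function : rank_function (image_rank h).
Proof.
split=> [p q r s pq qr rs|//|t].
- case: r => [r||] in qr rs *; last 2 first.
  + by move: rs; rewrite ltNge leey.
  + by move: qr; rewrite ltNge leNye.
  have [W [g gE]] := later_rank rs.
  have qr' := ltW qr; have pr' := ltW (lt_trans pq qr).
  have := @dim_quotient_leE _ _ _ g idfun _ _ (subspace_himage q r)
    (subspace_himage p r) (@image_subset _ _ (h r) _ _ (image_set_mono (V := V) (ltW pq) qr'))
    (himage_finite qr).
  rewrite !image_idfun => dim_le.
  have {}dim_le := dim_le (fun x _ x0 => etrans (congr1 g x0) (linear0 g)).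
  rewrite rank_muE subr_ge0 /= -(gE _ qr').2 -(gE _ pr').2.
  exact: dim_le_diff dim_le.
- case: t => [t||] //=; rewrite image_set1 linear0 (set_dimE (has_dim0 _)) //.
Qed.

End Image.

Lemma idfun_morphism V : module_morphism (fun a : R => idfun : {linear V a -> V a}).
Proof. by []. Qed.

Lemma pm_rank_function V : q_tame V -> rank_function (pm_rank V).
Proof.
by move=> qV; rewrite pm_rankE; apply: image_rank_function => //; exact: idfun_morphism.
Qed.

(** The hypotheses say that the kernel and the cokernel of [h] vanish after
    shifting by [e]. The four inequalities asked for by [image_matching] are
    instances of [dim_quotient_le]. For two of them the subspaces are images in
    [V] and the maps are [h] or the shift by [e], which kills the kernel of [h];
    for the others the subspaces are images in [U], where the shift of the image
    of [U] by [e] is contained in the image of [V]. *)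
Lemma morphism_matching V U (h : forall a, {linear V a -> U a}) (e : R) :
  0 <= e -> q_tame V -> q_tame U -> module_morphism h ->
  (forall a b (hab : a <= b) x, b = a + e -> h a x = 0 -> pm_map V hab x = 0) ->
  (forall a b (hab : a <= b) y, b = a + e -> exists x, pm_map U hab y = h b x) ->
  shift_matched e (dgm V) (dgm U).
Proof.
move=> e0 qV qU hM hker hcoker; rewrite !dgm_rank_dgm.
have le_e t : t <= t + e by rewrite lerDl.
apply: (@image_matching _ _ (image_rank h)) => //.
- exact: pm_rank_function.
- exact: image_rank_function.
- exact: pm_rank_function.
- rewrite pm_rankE /increment => p q [t||] pq qt //=; apply: dim_le_diff.
  apply: dim_quotient_leE => //.
  + exact: subspace_image_set.
  + exact: subspace_image_set.
  + by apply: image_set_mono; exact: ltW.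
  + exact: image_set_finite.
  + by move=> x _ /= ->; rewrite linear0.
- rewrite pm_rankE /increment => p q [t||] pq qt //=.
  have qt' := ltW qt; have pt' := ltW (lt_trans pq qt).
  rewrite !image_idfun.
  rewrite -(image_set_map (le_e t) qt') -(image_set_map (le_e t) pt').
  apply: dim_le_diff; apply: dim_quotient_leE => //.
  + exact: subspace_image_set.
  + exact: subspace_image_set.
  + by apply: image_set_mono => //; exact: ltW.
  + exact: image_set_finite.
  + by move=> x _; exact: hker.
- move=> s [t||] t' st tt'; last 2 first.
  + by move: tt'; rewrite ltNge leey.
  + by move: st; rewrite ltNge leNye.
  have st' := ltW st; have [W [g gE]] := later_rank hM tt'.
  rewrite -(gE _ st').1 -(gE _ st').2.
  have := @dim_quotient_leE _ _ _ g idfun _ _ (subspace_image_set U s t)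
    (subspace_himage h s t) (himage_sub hM st') (image_set_finite qU st)
    (fun x _ x0 => etrans (congr1 g x0) (linear0 g)).
  rewrite !image_idfun [leqLHS]addnC pm_rankE /= image_idfun.
  exact: dim_le_diff.
- move=> s [t||] t' st tt'; last 2 first.
  + by move: tt'; rewrite ltNge leey.
  + by move: st; rewrite ltNge leNye.
  have st' := ltW st; have [W [g gE]] := later_rank hM tt'.
  have se : (s - e%:E <= s)%E by rewrite leeBlDr // leeDl // lee_fin.
  have set' := le_trans se st'.
  rewrite -(gE _ set').1 -(gE _ st').2.
  have UV : image_set U (s - e%:E)%E t `<=` h t @` image_set V s t.
    case: s => [s||] in st st' se set' *; last 2 first.
    - by move: st'; rewrite leNgt ltry.
    - by move=> _ ->; exists 0; [have [] := subspace_image_set V -oo%E t|exact: linear0].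
    rewrite -EFinB !lee_fin in st' se set' *; rewrite !image_setE => _ [y _ <-].
    have [x E] := hcoker _ _ se y (esym (subrK _ _)).
    exists (pm_map V st' x); first by exists x.
    by rewrite hM -E (pm_comp se st' set').
  have := @dim_quotient_leE _ _ _ g idfun _ _ (subspace_himage h s t)
    (subspace_image_set U (s - e%:E)%E t) UV (himage_finite h qV st)
    (fun x _ x0 => etrans (congr1 g x0) (linear0 g)).
  rewrite !image_idfun [leqLHS]addnC pm_rankE /= image_idfun.
  exact: dim_le_diff.
Qed.

End Morphism.

(** * Homology and retractions of vertices *)

Section HomologyRetraction.
Variables (k : fieldType) (T : choiceType).
Implicit Types (K : scomplex T) (A : set T).

Lemma hclass_eq K (z z' : cycles k K) : hclass z = hclass z' <->
  exists2 c, is_chain K c & cycle_val z = cycle_val z' + boundary c.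
Proof.
rewrite /hclass quotmod_piP; split=> [/asboolP[c Kc E]|[c Kc E]].
  by exists c => //; rewrite -E [cycle_val (_ - _)](raddfB (val : cycles k K -> _)) addrC subrK.
apply/asboolP; exists c => //.
by rewrite [cycle_val (_ - _)](raddfB (val : cycles k K -> _)) /= E addrC addKr.
Qed.

Lemma hclass_eq0 K (z : cycles k K) : hclass z = 0 <->
  exists2 c, is_chain K c & cycle_val z = boundary c.
Proof.
have -> : 0 = hclass (0 : cycles k K) by rewrite /hclass linear0.
rewrite hclass_eq; split=> -[c Kc E]; exists c => //.
  by rewrite E [cycle_val 0](raddf0 (val : cycles k K -> _)) add0r.
by rewrite E [cycle_val 0](raddf0 (val : cycles k K -> _)) add0r.
Qed.

Lemma cycleP K (z : cycles k K) : is_cycle K (cycle_val z).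
Proof. by case: z => c /= /asboolP. Qed.

Lemma cycle_exists K (c : seq T -> k^o) : is_cycle K c ->
  exists z : cycles k K, cycle_val z = c.
Proof. by move=> /asboolT cP; exists (Cycle cP). Qed.

Variables (K0 K K1 : scomplex T) (A : set T) (r : T -> T).
Hypotheses (K01 : simplex K0 `<=` simplex K1) (K0K : simplex K0 `<=` simplex K)
  (KK1 : simplex K `<=` simplex K1) (rK : vertex_retraction K A r).

(** Push a representative to [A]; the homotopy stays in [K]. *)
Lemma homology_retract (x : homology k K0) :
  exists z : cycles k K1, [/\ homology_incl K01 x = hclass z,
    is_chain K (cycle_val z) &
    forall s, cycle_val z s != 0 -> [set` s] `<=` A].
Proof.
have [z ->] := hclass_surj x; have [Kz z0] := cycleP z.
have [|c' [d [Kc' Kd c'A bE E]]] := retract_chain rK (is_chain_incl K0K Kz).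
  by move=> s; rewrite z0 eqxx.
have [|z' z'E] := @cycle_exists K1 c'.
  by split; [exact: is_chain_incl Kc'|rewrite bE].
exists z'; rewrite z'E; split=> //; rewrite homology_inclE.
apply/hclass_eq; exists d; first exact: is_chain_incl Kd.
by rewrite z'E.
Qed.

(** If a cycle on [A] bounds a chain, then pushing this chain to [A] leaves its
    boundary in place, so the cycle bounds on [A] already. *)
Lemma homology_retract0 K2 (K2A : forall s, simplex K2 s -> s `<=` A)
    (K1' : scomplex T)
    (KK1' : forall s, simplex K s -> s `<=` A -> simplex K1' s)
    (K20 : simplex K2 `<=` simplex K0) (K21 : simplex K2 `<=` simplex K1')
    (x : homology k K2) :
  homology_incl K20 x = 0 -> homology_incl K21 x = 0.
Proof.
have [z ->] := hclass_surj x; have [Kz z0] := cycleP z.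
rewrite !homology_inclE => /hclass_eq0[c Kc zE]; rewrite /= in zE.
have [|c' [d [Kc' Kd c'A bE E]]] := retract_chain rK (is_chain_incl K0K Kc).
  by move=> s; rewrite -zE; case: Kz => _ zK _ _ /zK /K2A.
apply/hclass_eq0; exists c'; last by rewrite bE.
case: Kc' => c'f c'K c'u c'a; split=> // s c's.
by apply: KK1'; [exact: c'K|exact: c'A].
Qed.

Fixpoint words (l : seq T) (n : nat) : seq (seq T) :=
  if n is m.+1 then
    [::] :: flatten [seq [seq x :: s | s <- words l m] | x <- l]
  else [:: [::]].

Lemma mem_words l n s : (size s <= n)%N -> {subset s <= l} -> s \in words l n.
Proof.
elim: n s => [|n IH] [|x s] //= sn sl; rewrite inE; apply/flattenP.
exists [seq x :: s0 | s0 <- words l n].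
  by apply/mapP; exists x => //; apply: sl; rewrite mem_head.
by apply/map_f/IH => // y ys; apply: sl; rewrite inE ys orbT.
Qed.

(** Independent classes in the image come from independent cycles on [A], and
    these are functions on the finitely many words in [A] without repetition. *)
Lemma finite_retract_rank : finite_set A ->
  exists n, has_dim (range (@homology_incl k T K0 K1 K01)) n.
Proof.
move=> /finite_seqP[l lE].
pose W := words l (size l); pose N := size W.
apply: (@has_dim_bounded _ _ _ N) => m b bA bI.
have /choice[z zP] i : exists z : cycles k K1, b i = hclass z /\
    forall s, cycle_val z s != 0 -> s \in W.
  have [x _ <-] := bA i; have [z [-> [_ _ zu _] zA]] := homology_retract x.
  exists z; split=> // s zs; apply: mem_words; last first.
    by move=> y ys; have := zA s zs y ys; rewrite lE.
  apply: uniq_leq_size; first by apply: contraNT zs => /zu ->.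
  by move=> y ys; have := zA s zs y ys; rewrite lE.
pose f i : 'rV[k]_N := \row_j cycle_val (z i) (nth [::] W j).
have fI : independent f.
  move=> c fc; apply: bI.
  have zc : \sum_i c i *: z i = 0.
    apply: val_inj; rewrite (raddf_sum (val : cycles k K1 -> _)) raddf0.
    apply/funext => s; rewrite fct_sumE.
    have [sW|sW] := boolP (s \in W); last first.
      rewrite big1 // => i _; have [_ /(_ s) h] := zP i.
      have /eqP zs : cycle_val (z i) s == 0 by apply: contraNT sW; exact: h.
      by change (c i * (cycle_val (z i) s : k) = 0); rewrite zs mulr0.
    have sN : (index s W < N)%N by rewrite index_mem.
    have /matrixP/(_ 0 (Ordinal sN)) := fc.
    rewrite summxE mxE => fc0; rewrite -[RHS]fc0; apply: eq_bigr => i _.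
    by rewrite !mxE /= nth_index.
  transitivity (hclass (\sum_i c i *: z i)).
    rewrite /hclass linear_sum; apply: eq_bigr => i _.
    by rewrite linearZ; have [-> _] := zP i.
  by rewrite zc /hclass linear0.
have fS i : in_span (fun j : 'I_N => delta_mx 0 j : 'rV[k]_N) (f i).
  by exists (f i 0); exact: row_sum_delta.
by have := independent_card_le fI fS; rewrite !card_ord.
Qed.

End HomologyRetraction.

(** * Cech complexes *)

Section Cech.
Variables (k : fieldType) (R : realType) (X : metricType R).
Implicit Types (L M A W : set X) (a b e : R).

(** A complex between the Cech complexes at [a] and [b], chosen so that it
    allows points outside [A] to be moved to [A] by a distance of [b - a], and
    that it is the Cech complex at [b] on the simplices in [A]. *)
Definition cylinder_simplex M A W a b : set (set X) :=
  [set s | [/\ finite_set s, s !=set0, s `<=` M &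
    exists2 w, W w & forall x, s x ->
      mdist w x <= b /\ (~ A x -> mdist w x <= a)]].

Lemma cylinder_face M A W a b s t : cylinder_simplex M A W a b s ->
  t `<=` s -> t !=set0 -> cylinder_simplex M A W a b t.
Proof.
move=> [sf _ sM [w Ww wd]] ts t0; split => //.
- exact: sub_finite_set ts sf.
- exact: subset_trans ts sM.
- by exists w => // x /ts /wd.
Qed.

Definition cylinder M A W a b : scomplex X :=
  @SComplex X (cylinder_simplex M A W a b)
  (fun s => fun '(And4 sf _ _ _) => sf) (fun s => fun '(And4 _ s0 _ _) => s0)
  (@cylinder_face M A W a b).

Lemma cech_sub_cylinder M A W a b : a <= b ->
  simplex (cech M W a) `<=` simplex (cylinder M A W a b).
Proof.
move=> ab s [sf s0 sM [w Ww wd]]; split=> //; exists w => // x sx.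
by split=> [|_]; [exact: le_trans (wd x sx) ab|exact: wd].
Qed.

Lemma cylinder_sub_cech M A W a b :
  simplex (cylinder M A W a b) `<=` simplex (cech M W b).
Proof.
by move=> s [sf s0 sM [w Ww wd]]; split=> //; exists w => // x /wd[].
Qed.

Lemma cylinder_retraction M A W a b (r : X -> X) : A `<=` M ->
  (forall x, M x -> A (r x) /\ mdist x (r x) <= b - a) ->
  vertex_retraction (cylinder M A W a b) A r.
Proof.
move=> AM rM s v [sf s0 sM [w Ww wd]] sv nAv.
have [Arv dv] := rM v (sM v sv); split=> //; split.
- by rewrite finite_setU; split.
- by exists v; left.
- by move=> x [/sM//|->]; exact: AM.
exists w => // x [/wd//|->]; split=> //.
rewrite (le_trans (metric_triangle _ v _)) // -(subrKC a b) lerD //.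
by have [_] := wd v sv; exact.
Qed.

Lemma nearby_map M A e : (forall x, M x -> exists2 y, A y & mdist x y <= e) ->
  exists r : X -> X, forall x, M x -> A (r x) /\ mdist x (r x) <= e.
Proof.
move=> MA; have /choice[r rP] x : exists y, M x -> A y /\ mdist x y <= e.
  have [Mx|nMx] := pselect (M x); last by exists x.
  by have [y Ay xy] := MA x Mx; exists y.
by exists r.
Qed.

(** If [L] is totally bounded, move its points to a finite net. If [W] is, replace
    it by a finite net [G]; points of [L] with the same neighbours in [G] are
    then interchangeable, and one representative of each of the finitely many
    types is enough. *)
Lemma cech_q_tame L W : totally_bounded L \/ totally_bounded W ->
  q_tame (cech_homology k L W).
Proof.
move=> bounded a b hab ab.
suff [K [A [r [aK Kb rK Af]]]] : exists K A r, [/\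
    simplex (cech L W a) `<=` simplex K, simplex K `<=` simplex (cech L W b),
    vertex_retraction K A r & finite_set A].
  exact: (finite_retract_rank k (cech_mono hab) aK Kb rK Af).
have ba : 0 < b - a by rewrite subr_gt0.
case: bounded => [/(_ _ ba)[F [Ff FL Fd]]|/(_ _ ba)[G [Gf GW Gd]]].
  have [|r rP] := @nearby_map L F (b - a).
    by move=> x /Fd[y Fy /ltW yx]; exists y; rewrite // metric_sym.
  exists (cylinder L F W a b), F, r; split=> //.
  - exact: cech_sub_cylinder.
  - exact: cylinder_sub_cech.
  - exact: cylinder_retraction.
have [l lE] := (finite_seqP _).1 Gf.
pose type (x : X) : (size l).-tuple bool := 
  [tuple mdist (tnth (in_tuple l) i) x <= b | i < size l].
(* A type without a point of [L] has no representative. *)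
pose rep t := xget None [set Some y | y in [set y | L y /\ type y = t]].
have repP v : L v -> exists y, [/\ rep (type v) = Some y, L y & type y = type v].
  move=> Lv; pose P := [set Some y | y in [set y | L y /\ type y = type v]].
  have [y [Ly ty] yE] : P (rep (type v)).
    by apply: (xgetPex None (P := P)); exists (Some v), v.
  by exists y.
exists (cech L G b), (Some @^-1` range rep), (fun x => odflt x (rep (type x))); split.
- move=> s [sf s0 sL [w Ww wd]]; split=> //; have [g Gg gw] := Gd w Ww.
  exists g => // x sx; rewrite (le_trans (metric_triangle _ w _)) //.
  by rewrite -(subrK a b) lerD ?wd // metric_sym ltW.
- by move=> s [sf s0 sL [w Gw wd]]; split=> //; exists w => //; exact: GW.
- move=> s v [sf s0 sL [g Gg gd]] sv _; have [y [ry Ly ty]] := repP v (sL v sv).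
  rewrite ry /=; split; first by exists (type v).
  split.
  + by rewrite finite_setU; split.
  + by exists v; left.
  + by move=> x [/sL//|->].
  + exists g => // x [/gd//|->].
    have gl : g \in l by rewrite lE in Gg.
    have /tnthP[i gi] : g \in in_tuple l by [].
    have := congr1 (fun t => tnth t i) ty; rewrite !tnth_mktuple -gi.
    by rewrite (gd v sv).
- have Some_inj : injective (@Some X) by move=> ? ? [].
  apply: (finite_preimage (in2W Some_inj)).
  by apply: finite_image; exact: finite_finset.
Qed.

Lemma cech_shift_matched L M W e : 0 <= e -> L `<=` M ->
  (totally_bounded L \/ totally_bounded W) ->
  (totally_bounded M \/ totally_bounded W) ->
  (forall x, M x -> exists2 y, L y & mdist x y <= e) ->
  shift_matched e (dgm (cech_homology k L W)) (dgm (cech_homology k M W)).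
Proof.
move=> e0 LM Lb Mb /nearby_map[r rM].
have inc a : simplex (cech L W a) `<=` simplex (cech M W a).
  by move=> s [sf s0 sL sw]; split=> // x /sL /LM.
apply: (@morphism_matching k R (cech_homology k L W) (cech_homology k M W)
  (fun a => homology_incl (inc a))) => //.
- exact: cech_q_tame.
- exact: cech_q_tame.
- move=> a b ab x; have inc' s : simplex (cech L W a) s -> simplex (cech M W b) s.
    by move=> /inc /(cech_mono ab).
  by rewrite /= !(homology_incl_comp _ _ inc').
- move=> a b ab x bE.
  have be : b - a = e by rewrite bE addrC addKr.
  have rcyl : vertex_retraction (cylinder M L W a b) L r.
    by apply: cylinder_retraction => //; rewrite be.
  apply: (homology_retract0 (@cech_sub_cylinder M L W a b ab) rcyl).
  + by move=> s [].
  + move=> s /cylinder_sub_cech [sf s0 _ sw] sL; split=> //.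
- move=> a b ab y bE.
  have be : b - a = e by rewrite bE addrC addKr.
  have rcyl : vertex_retraction (cylinder M L W a b) L r.
    by apply: cylinder_retraction => //; rewrite be.
  have [z [E [zf zK zu za] zL]] := homology_retract (cech_mono ab)
    (@cech_sub_cylinder M L W a b ab) (@cylinder_sub_cech M L W a b) rcyl y.
  have [|z' z'E] := @cycle_exists _ _ (cech L W b) (cycle_val z).
    split; last by have [_] := cycleP z.
    split=> // s zs; have [sf s0 _ sw] := cylinder_sub_cech (zK s zs).
    by split=> //; exact: zL.
  exists (hclass z'); apply: etrans E _.
  apply: etrans (esym (homology_inclE (inc b) z')).
  by congr hclass; apply: val_inj; rewrite /= z'E.
Qed.

Lemma totally_boundedU L M :
  totally_bounded L -> totally_bounded M -> totally_bounded (L `|` M).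
Proof.
move=> Lb Mb e e0; have [F [Ff FL Fd]] := Lb e e0; have [G [Gf GM Gd]] := Mb e e0.
exists (F `|` G); split; first by rewrite finite_setU.
  exact: setUSS.
by move=> x [/Fd[y]|/Gd[y]]; exists y => //; [left|right].
Qed.

End Cech.

Section Composition.
Variable R : realType.

Lemma half_length_le (x y : \bar R) (e : R) :
  (x < y)%E -> (y <= x + e%:E + e%:E)%E -> ((2^-1)%:E * (y - x) <= e%:E)%E.
Proof.
case: x y => [x||] [y||] //; rewrite -?EFinD -?EFinB -?EFinM !lee_fin => xy yx.
rewrite -ler_pdivlMl ?invr_gt0 // invrK; lra.
Qed.

(** Points of [D] and [D'] are matched if they are matched to the same point of
    [DU]. A point left unmatched is short itself, or it is matched to a short
    point [(b, d)] of [DU], and then it is born after [b] and dies before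
    [d + e], hence lives for at most [2 * e]. *)
Lemma bottleneck_le (D D' DU : diagram R) (e : R) : 0 <= e ->
  (forall u, points D u -> (u.1.1 < u.1.2)%E) ->
  (forall u, points D' u -> (u.1.1 < u.1.2)%E) ->
  shift_matched e D DU -> shift_matched e D' DU ->
  (bottleneck D D' <= e%:E)%E.
Proof.
move=> e0 Dlt Dlt' [M [[pts func inj] close short shortU]]
  [M' [[pts' func' inj'] close' short' shortU']].
apply: ereal_inf_lbound; exists e => //; split=> //.
have mid (x x' z : \bar R) : (z <= x)%E -> (x <= z + e%:E)%E -> (z <= x')%E ->
    (x' <= z + e%:E)%E -> coord_close e x x'.
  case: x x' z => [x||] [x'||] [z||] //=; rewrite -?EFinD ?lee_fin //.
  by move=> *; rewrite ler_norml; lra.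
have shift_le (x y : \bar R) : (x <= y)%E -> (x + e%:E <= y + e%:E)%E.
  by move=> xy; rewrite leeD.
exists (fun u w => exists2 v, M u v & M' w v); split.
- by move=> u w [v /pts[pu _] /pts'[pw _]].
- by move=> u w w' [v uv wv] [v' /(func _ _ _ uv) <- /(inj' _ _ _ wv)].
- by move=> u u' w [v uv wv] [v' uv' /(func' _ _ _ wv) vv']; subst v'; exact: inj uv uv'.
- move=> u w [v /close[a1 a2 a3 a4] /close'[b1 b2 b3 b4]].
  by split; [exact: (mid _ _ v.1.1)|exact: (mid _ _ v.1.2)].
- have unmatched (D1 : diagram R) N N' (u : \bar R * \bar R * nat) :
      (forall u, points D1 u -> (u.1.1 < u.1.2)%E) ->
      (forall u v, N u v -> points D1 u /\ points DU v) ->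
      (forall u v, N u v -> [/\ (v.1.1 <= u.1.1)%E, (u.1.1 <= v.1.1 + e%:E)%E,
         (v.1.2 <= u.1.2)%E & (u.1.2 <= v.1.2 + e%:E)%E]) ->
      (forall u, points D1 u -> (forall v, ~ N u v) -> (u.1.2 <= u.1.1 + e%:E)%E) ->
      (forall v, points DU v -> (forall u, ~ N' u v) -> (v.1.2 <= v.1.1 + e%:E)%E) ->
      points D1 u -> (forall w, ~ exists2 v, N u v & N' w v) ->
      ((2^-1)%:E * (u.1.2 - u.1.1) <= e%:E)%E.
    move=> D1lt ptsN closeN shortN shortN' pu nM.
    apply: half_length_le; first exact: D1lt.
    have [[v uv]|nv] := pselect (exists v, N u v); last first.
      apply: le_trans (_ : _ <= u.1.1 + e%:E)%E _.
        by apply: shortN => // v uv; apply: nv; exists v.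
      by rewrite leeDl ?lee_fin.
    have [a1 a2 a3 a4] := closeN _ _ uv.
    apply: le_trans a4 _; apply: (shift_le _ _ _).
    apply: le_trans _ (shift_le _ _ a1).
    apply: shortN' => [|w wv]; first by have [] := ptsN _ _ uv.
    by apply: (nM w); exists v.
  split=> [u pu nM|w pw nM].
    exact: (unmatched _ D M M' u).
  apply: (unmatched _ D' M' M) => // u [v wv uv]; apply: (nM u).
  by exists v.
Qed.

End Composition.

Theorem theorem5p6 (k : fieldType) (R : realType) (X : metricType R)
    (L L' W : set X)
    (bounded : (totally_bounded L /\ totally_bounded L') \/ totally_bounded W) :
  (bottleneck (dgm (cech_homology k L W)) (dgm (cech_homology k L' W))
     <= hausdorff_dist L L')%E.
Proof.
apply: le_ereal_inf_tmp => _ [e [e0 LL' L'L] <-].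
have dgm_lt (V : persmod k R) u : points (dgm V) u -> (u.1.1 < u.1.2)%E.
  by rewrite /points /= /dgm; case: ifP.
have [Lb Lb' Ub] : [/\ totally_bounded L \/ totally_bounded W,
    totally_bounded L' \/ totally_bounded W &
    totally_bounded (L `|` L') \/ totally_bounded W].
  case: bounded => [[Lb Lb']|Wb]; last by split; right.
  by split; left => //; exact: totally_boundedU.
have self x : mdist x x <= e by rewrite mdistxx.
apply: (bottleneck_le (DU := dgm (cech_homology k (L `|` L') W))) => //.
- exact: dgm_lt.
- exact: dgm_lt.
- apply: cech_shift_matched => // x [Lx|/L'L[y Ly xy]]; first by exists x.
  by exists y => //; rewrite metric_sym.
- apply: cech_shift_matched => // x [/LL'[y Ly xy]|Lx]; last by exists x.
  by exists y.
Qed.
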